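(* Let $(\alpha_i)_{i<\omega}$ be a sequence of ordinals and let $X$ denote the set of all sequences $a=(a_i)_{i<\omega}$ with $a_i\in\alpha_i$ for every $i$ and $a_i\neq 0$ for only finitely many $i$ (the finite-support cartesian product of the $\alpha_i$). Then the infinite natural product $\bigotimes_{i<\omega}\alpha_i$ is the order-type of some finitely Carruth linear order on $X$. Moreover, every (locally) finitely Carruth linear order on $X$ is a well-order, and $\bigotimes_{i<\omega}\alpha_i$ is the largest order-type among all such orderings.
   Context: For ordinals, $\otimes$ denotes the (Hessenberg) natural product. For a sequence $(\alpha_i)_{i<\omega}$, let $P_n=\alpha_0\otimes\dots\otimes\alpha_{n-1}$ (with $P_0=1$) and define the infinite natural product $\bigotimes_{i<\omega}\alpha_i=\lim_{n<\omega}P_n$, i.e. it is $0$ if some $\alpha_i=0$ and $\sup_{n<\omega}P_n$ otherwise. $X$ is the set of elements $a=(a_i)_{i<\omega}$ of the cartesian product $\alpha_0\times\alpha_1\times\cdots$ whose support $\{i: a_i\neq 0\}$ is finite. On $X$ let $<_\times^0$ be the componentwise partial order ($a\le b$ iff $a_i\le b_i$ for all $i$); on the finite cartesian product $\alpha_0\times\dots\times\alpha_{n-1}$ let $<_\times$ be the componentwise order. For $a\neq b$ in $X$, let $\mathrm{diff}(a,b)$ be the largest index $i$ in the union of the supports of $a$ and $b$ with $a_i\neq b_i$. For $a\in X$ and $n<\omega$, $a_{\restriction n}=(a_i)_{i<n}\in\alpha_0\times\dots\times\alpha_{n-1}$. A linear order $<'$ on $X$ is finitely Carruth if $<'$ extends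 $<_\times^0$ and there are $n<\omega$ and a linear order $<''$ on $\alpha_0\times\dots\times\alpha_{n-1}$ extending $<_\times$ such that for all $a\neq b$ in $X$ with $i=\mathrm{diff}(a,b)$: (1) if $i\ge n$ then $a<'b$ iff $a_i<b_i$; (2) if $i<n$ then $a<'b$ iff $a_{\restriction n}<''b_{\restriction n}$. A linear order $<'$ on $X$ is locally finitely Carruth if $<'$ extends $<_\times^0$ and for every $c\in X$ there is $n_c<\omega$ such that for all $a\neq b$ in $X$ with $a,b<'c$ and $\mathrm{diff}(a,b)\ge n_c$, we have $a<'b$ iff $a_i<b_i$ where $i=\mathrm{diff}(a,b)$. Every finitely Carruth order is locally finitely Carruth. *)

(* Defs.v *)
From HB Require Import structures.
From mathcomp Require Import all_boot all_order.
From mathcomp Require Import boolp classical_sets functions cardinality wochoice.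
Set Implicit Arguments.
Unset Strict Implicit.
Unset Printing Implicit Defensive.
Import Order.TTheory.
Local Open Scope classical_set_scope.
Local Open Scope order_scope.
Local Open Scope quotient_scope.

(* [otree f] denotes the least ordinal strictly above all the [f i]; two trees
   with the same denotation are identified in the quotient [Ord] below. *)
Inductive otree : Type := OTree (I : Type) (f : I -> otree).

HB.instance Definition _ := gen_eqMixin otree.
HB.instance Definition _ := gen_choiceMixin otree.

Fixpoint otree_le (s t : otree) {struct s} : Prop :=
  let: OTree _ f := s in let: OTree _ g := t in
  forall i, exists j, otree_le (f i) (g j).

Lemma otree_le_refl s : otree_le s s.
Proof. by elim: s => I f IH /= i; exists i. Qed.

Lemma otree_le_trans t s u : otree_le s t -> otree_le t u -> otree_le s u.
Proof.
elim: s t u => I f IH [J g] [K h] /= fg gh i.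
have [j fgij] := fg i; have [k ghjk] := gh j.
by exists k; apply: IH fgij ghjk.
Qed.

Lemma otree_le_total s t : otree_le s t \/ otree_le t s.
Proof.
elim: s t => I f IH [J g]; have [fg|] := pselect (otree_le (OTree f) (OTree g)).
  by left.
move=> /existsNP [i /forallNP fiNg]; right => /= j; exists i.
by have [/fiNg|] := IH i (g j).
Qed.

Definition otree_eqv : rel otree :=
  fun s t => `[< otree_le s t /\ otree_le t s >].

Lemma otree_eqv_refl : reflexive otree_eqv.
Proof. by move=> s; apply/asboolP; split; apply: otree_le_refl. Qed.

Lemma otree_eqv_sym : symmetric otree_eqv.
Proof. by move=> s t; apply/asboolP/asboolP => -[]. Qed.

Lemma otree_eqv_trans : transitive otree_eqv.
Proof.
move=> t s u /asboolP[st ts] /asboolP[tu ut]; apply/asboolP.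
by split; [apply: otree_le_trans st tu | apply: otree_le_trans ut ts].
Qed.

Canonical otree_eqv_equiv :=
  EquivRel otree_eqv otree_eqv_refl otree_eqv_sym otree_eqv_trans.

Definition Ord : Type := {eq_quot otree_eqv}.

HB.instance Definition _ := Choice.on Ord.
HB.instance Definition _ := EqQuotient.on Ord.

Definition ord_le : rel Ord := fun x y => `[< otree_le (repr x) (repr y) >].

Lemma ord_le_anti : antisymmetric ord_le.
Proof.
move=> x y /andP[/asboolP xy /asboolP yx].
by rewrite -(reprK x) -(reprK y); apply/eqmodP/asboolP; split.
Qed.

Lemma ord_le_trans : transitive ord_le.
Proof.
move=> y x z /asboolP xy /asboolP yz; apply/asboolP.
exact: otree_le_trans xy yz.
Qed.

Lemma ord_le_total : total ord_le.
Proof.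
move=> x y; have [xy|yx] := otree_le_total (repr x) (repr y).
  by apply/orP; left; apply/asboolP.
by apply/orP; right; apply/asboolP.
Qed.

Fact ord_display : Order.disp_t. Proof. exact: (Order.Disp tt tt). Qed.

HB.instance Definition _ := @Order.isOrder.Build ord_display Ord
  ord_le _ _ _ (fun _ _ => erefl) (fun _ _ => erefl) (fun _ _ => erefl)
  ord_le_anti ord_le_trans ord_le_total.

Lemma ord_piE s t : (\pi_Ord s <= \pi_Ord t) = `[< otree_le s t >].
Proof.
have pr u : otree_le (repr (\pi_Ord u)) u /\ otree_le u (repr (\pi_Ord u)).
  have /eqmodP/asboolP[] : repr (\pi_Ord u) = u %[mod Ord] by rewrite reprK.
  by split.
apply/asboolP/asboolP => st.
  exact: otree_le_trans (pr s).2 (otree_le_trans st (pr t).1).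
exact: otree_le_trans (pr s).1 (otree_le_trans st (pr t).2).
Qed.

Lemma otree_leNgt I (f : I -> otree) t :
  ~ otree_le (OTree f) t <-> exists i, otree_le t (f i).
Proof.
split=> [|[i tfi] ft].
  move: I f t; suff H s : forall t, ~ otree_le s t ->
      let: OTree _ f := s in exists i, otree_le t (f i).
    by move=> I f; apply: (H (OTree f)).
  elim: s => I f IH [J g] /= /existsNP[i /forallNP fiNg]; exists i.
  by case: (f i) (IH i) fiNg => K h IHi fiNg j; apply/IHi/fiNg.
have {t tfi ft} : otree_le (OTree f) (f i) by apply: otree_le_trans ft tfi.
suff H s : let: OTree _ f := s in forall i, ~ otree_le s (f i).
  exact: (H (OTree f)).
elim: s {f i} => {}I f IH i.
by case E: (f i) (IH i) => [K h] IHi fh; have [k] := fh i; rewrite E => /IHi.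
Qed.

Lemma ord_lt_piP I (f : I -> otree) (x : Ord) :
  x < \pi_Ord (OTree f) <-> exists i, x <= \pi_Ord (f i).
Proof.
rewrite -(reprK x) ltNge ord_piE; split.
  move=> /asboolPn/otree_leNgt[i xfi]; exists i.
  by rewrite ord_piE; apply/asboolP.
move=> [i]; rewrite ord_piE => /asboolP xfi.
by apply/asboolPn/otree_leNgt; exists i.
Qed.

Lemma ord_ind_le (P : Ord -> Prop) :
  (forall I (f : I -> otree), (forall i, P (\pi_Ord (f i))) ->
    P (\pi_Ord (OTree f))) -> forall x, P x.
Proof. by move=> H x; rewrite -(reprK x); elim: (repr x). Qed.

Lemma ord_lt_wf : well_founded (fun x y : Ord => x < y).
Proof.
elim/ord_ind_le => I f IH; constructor => x /ord_lt_piP[i].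
by rewrite le_eqVlt => /predU1P[->//|]; apply: (Acc_inv (IH i)).
Qed.

(* Ordinals below a given one form a small collection, hence families indexed
   by them are bounded: this is what makes the suprema below genuine. *)
Lemma ord_replacement (F : Ord -> Ord) (x : Ord) :
  exists z, forall y, y < x -> F y < z.
Proof.
elim/ord_ind_le: x => I f IH.
have {}IH i : exists z, forall y, y <= \pi_Ord (f i) -> F y <= z.
  have [z zP] := IH i; exists (Order.max z (F (\pi_Ord (f i)))) => y.
  rewrite le_max le_eqVlt => /predU1P[->|/zP/ltW->//].
  by rewrite lexx orbT.
have [g gP] := choice IH.
exists (\pi_Ord (OTree (fun i => repr (g i)))) => y /ord_lt_piP[i yfi].
by apply/ord_lt_piP; exists i; rewrite reprK; apply: gP.
Qed.

Lemma ord_seq_bounded I (u : I -> Ord) : exists z, forall i, u i < z.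
Proof.
exists (\pi_Ord (OTree (repr \o u))) => i.
by apply/ord_lt_piP; exists i; rewrite reprK.
Qed.

Definition ozero : Ord := \pi_Ord (OTree (of_void otree)).

Definition ord_min (A : set Ord) : Ord :=
  xget ozero [set m | A m /\ lbound A m].

Definition ord_sup (A : set Ord) : Ord := ord_min (ubound A).

Definition ord_succ (x : Ord) : Ord := ord_min [set y | x < y].

Definition oone : Ord := ord_succ ozero.

Definition omega : Ord := ord_sup (range (fun n => iter n ord_succ ozero)).

Lemma ozero_le x : ozero <= x.
Proof. by rewrite leNgt; apply/negP => /ord_lt_piP[]. Qed.

Lemma ord_minP (A : set Ord) : A !=set0 -> A (ord_min A) /\ lbound A (ord_min A).
Proof.
move=> [x Ax]; apply: (@xgetPex _ ozero [set m | A m /\ lbound A m]).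
elim/(well_founded_ind ord_lt_wf): x Ax => x IH Ax.
have [lbx|] := pselect (lbound A x); first by exists x.
by move=> /existsNP[y /not_implyP[Ay /negP]]; rewrite -ltNge => /IH; apply.
Qed.

Lemma ord_supP (A : set Ord) :
  has_ubound A -> ubound A (ord_sup A) /\ forall y, ubound A y -> ord_sup A <= y.
Proof. exact: ord_minP. Qed.

Lemma ord_succP x y : (ord_succ x <= y) = (x < y).
Proof.
have [|xs sx] := @ord_minP [set y | x < y].
  by have [z /(_ tt)] := @ord_seq_bounded unit (fun=> x); exists z.
by apply/idP/idP => [|/sx//]; apply: lt_le_trans.
Qed.

(* Transfinite iteration of an inflationary [G] from [z]: [z] at [0], [G] of
   the previous value at successors, suprema at limits. *)
Definition ord_iter (G : Ord -> Ord) (z : Ord) : Ord -> Ord :=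
  Fix ord_lt_wf (fun=> Ord) (fun x rec =>
    ord_sup [set y | y = z \/ exists x' (h : x' < x), y = G (rec x' h)]).

Lemma ord_iterE G z x :
  ord_iter G z x = ord_sup (z |` [set G (ord_iter G z x') | x' in [set x' | x' < x]]).
Proof.
rewrite /ord_iter Fix_eq; last first.
  move=> y f g fg; congr ord_sup; apply/seteqP.
  by split=> w /= [->|[x' [h ->]]]; [left|right|left|right] => //; exists x', h; rewrite fg.
congr ord_sup; apply/seteqP; split=> w /= [->|H]; [by left|right|by left|right].
  by move: H => [x' [h ->]]; exists x'.
by move: H => [x' h <-]; exists x', h.
Qed.

Lemma ord_iterP G z x (F := ord_iter G z) :
  [/\ z <= F x, forall x', x' < x -> G (F x') <= F x &
      forall y, z <= y -> (forall x', x' < x -> G (F x') <= y) -> F x <= y].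
Proof.
rewrite {}/F; set F := ord_iter G z.
have [|ubF lbF] := @ord_supP (z |` [set G (F x') | x' in [set x' | x' < x]]).
  have [w wP] := ord_replacement (G \o F) x; exists (Order.max z w).
  by move=> _ [->|[x' x'x <-]]; rewrite le_max ?lexx// (ltW (wP _ x'x)) orbT.
rewrite -ord_iterE -/F in ubF lbF; split.
- by apply: ubF; left.
- by move=> x' x'x; apply: ubF; right; exists x'.
- by move=> y zy Gy; apply: lbF => _ [->//|[x' x'x <-]]; apply: Gy.
Qed.

Lemma ord_iter_le G z : {homo ord_iter G z : x y / x <= y}.
Proof.
move=> x y xy; have [z_le G_le _] := ord_iterP G z y.
have [_ _ le_G] := ord_iterP G z x.
by apply: le_G => // x' x'x; apply/G_le/(lt_le_trans x'x).
Qed.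

Lemma ord_iter0 G z : ord_iter G z ozero = z.
Proof.
have [z_le _ le_F] := ord_iterP G z ozero; apply/le_anti; rewrite z_le andbT.
by apply: le_F => // x'; rewrite ltNge ozero_le.
Qed.

Lemma ord_lt_succ x y : (x < ord_succ y) = (x <= y).
Proof. by rewrite ltNge ord_succP -leNgt. Qed.

Lemma ord_iterS G z x : {homo G : x y / x <= y} -> (forall x, x <= G x) ->
  ord_iter G z (ord_succ x) = G (ord_iter G z x).
Proof.
move=> G_homo G_infl; have [_ G_le le_G] := ord_iterP G z (ord_succ x).
apply/le_anti; rewrite G_le ?ord_lt_succ ?lexx// andbT; apply: le_G.
  by have [z_le _ _] := ord_iterP G z x; apply: le_trans z_le (G_infl _).
by move=> x'; rewrite ord_lt_succ => x'x; apply/G_homo/ord_iter_le.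
Qed.

Lemma ord_iter_lim G z x : (forall x, x <= G x) -> ozero < x ->
  (forall x', x' < x -> ord_succ x' < x) ->
  ord_iter G z x = ord_sup [set ord_iter G z x' | x' in [set x' | x' < x]].
Proof.
move=> G_infl x0 xlim; have [z_le G_le le_G] := ord_iterP G z x.
have [|ubF lbF] := @ord_supP [set ord_iter G z x' | x' in [set x' | x' < x]].
  by exists (ord_iter G z x) => _ [x' x'x <-]; apply/ord_iter_le/ltW.
apply/le_anti/andP; split; last first.
  by apply: lbF => _ [x' x'x <-]; apply/ord_iter_le/ltW.
apply: le_G => [|x' x'x].
  by apply: ubF; exists ozero; rewrite ?ord_iter0.
have [_ G_le' _] := ord_iterP G z (ord_succ x').
apply: le_trans (G_le' x' _) _; first by rewrite ord_lt_succ.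
by apply: ubF; exists (ord_succ x'); rewrite //=; apply: xlim.
Qed.

Definition ord_add (x y : Ord) : Ord := ord_iter ord_succ x y.
Definition ord_mul (x y : Ord) : Ord := ord_iter (ord_add^~ x) ozero y.
Definition omega_pow (x : Ord) : Ord := ord_iter (ord_mul^~ omega) oone x.

Lemma ord_succ_le : {homo ord_succ : x y / x <= y}.
Proof. by move=> x y xy; rewrite ord_succP ord_lt_succ. Qed.

Lemma ord_le_succ x : x <= ord_succ x.
Proof. by rewrite ltW// ord_lt_succ. Qed.

Lemma ord_addx0 x : ord_add x ozero = x.
Proof. exact: ord_iter0. Qed.

Lemma ord_addxS x y : ord_add x (ord_succ y) = ord_succ (ord_add x y).
Proof. by apply: ord_iterS; [apply: ord_succ_le|apply: ord_le_succ]. Qed.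

Lemma ord_add_le2r z : {homo ord_add^~ z : x y / x <= y}.
Proof.
move=> x y xy; elim/(well_founded_ind ord_lt_wf): z => z IH.
have [y_le S_le _] := ord_iterP ord_succ y z.
have [_ _ le_S] := ord_iterP ord_succ x z.
apply: le_S => [|z' z'z]; first exact: le_trans xy y_le.
by apply: le_trans (S_le _ z'z); apply/ord_succ_le/IH.
Qed.

Lemma ord_le_addr x y : x <= ord_add x y.
Proof. by have [] := ord_iterP ord_succ x y. Qed.

Lemma ord_add0x x : ord_add ozero x = x.
Proof.
elim/(well_founded_ind ord_lt_wf): x => x IH.
have [_ S_le le_S] := ord_iterP ord_succ ozero x; apply/le_anti/andP; split.
  by apply: le_S => [|x' x'x]; rewrite ?ozero_le// ord_succP [ord_iter _ _ _]IH.
rewrite leNgt; apply/negP => lt_x; have := S_le _ lt_x.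
by rewrite ord_succP [X in X < _](IH _ lt_x) ltxx.
Qed.

Lemma ord_mulx0 x : ord_mul x ozero = ozero.
Proof. exact: ord_iter0. Qed.

Lemma ord_mulxS x y : ord_mul x (ord_succ y) = ord_add (ord_mul x y) x.
Proof.
by apply: ord_iterS => [|z]; [apply: ord_add_le2r|apply: ord_le_addr].
Qed.

Lemma ord_mul_le2r z : {homo ord_mul^~ z : x y / x <= y}.
Proof.
move=> x y xy; elim/(well_founded_ind ord_lt_wf): z => z IH.
have [_ M_le _] := ord_iterP (ord_add^~ y) ozero z.
have [_ _ le_M] := ord_iterP (ord_add^~ x) ozero z.
apply: le_M => [|z' z'z]; first exact: ozero_le.
apply: le_trans (M_le _ z'z); apply: le_trans (ord_add_le2r _ (IH _ z'z)) _.
exact: ord_iter_le.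
Qed.

Lemma ord_le_mulomega x : x <= ord_mul x omega.
Proof.
rewrite -[leLHS]ord_add0x -[X in ord_add X _](ord_mulx0 x) -ord_mulxS.
apply: ord_iter_le; have [|ub _] := @ord_supP (range (fun n => iter n ord_succ ozero)).
  have [z zP] := ord_seq_bounded (fun n => iter n ord_succ ozero).
  by exists z => _ [n _ <-]; apply/ltW.
by apply: ub; exists 1%N.
Qed.

Lemma omega_pow0 : omega_pow ozero = oone.
Proof. exact: ord_iter0. Qed.

Lemma omega_powS x : omega_pow (ord_succ x) = ord_mul (omega_pow x) omega.
Proof. by apply: ord_iterS; [apply: ord_mul_le2r|apply: ord_le_mulomega]. Qed.

(* [cnf_val [:: e_1; ...; e_k]] is [omega^e_1 + ... + omega^e_k]; it is a Cantor
   normal form, with repetitions instead of coefficients, when the exponents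
   are nonincreasing. *)
Definition cnf_val (e : seq Ord) : Ord :=
  foldr (fun x => ord_add (omega_pow x)) ozero e.

Definition cnf (x : Ord) : seq Ord :=
  xget [::] [set e : seq Ord | sorted >=%O e /\ cnf_val e = x].

(* Hessenberg operations: Cantor normal forms are added and multiplied like
   polynomials in [omega]. *)
Definition nat_sum (x y : Ord) : Ord :=
  cnf_val (sort >=%O (cnf x ++ cnf y)).

Definition nat_prod (x y : Ord) : Ord :=
  cnf_val (sort >=%O [seq nat_sum e f | e <- cnf x, f <- cnf y]).

Fixpoint nat_prodn (alpha : nat -> Ord) (n : nat) : Ord :=
  if n is m.+1 then nat_prod (nat_prodn alpha m) (alpha m) else oone.

Definition inf_nat_prod (alpha : nat -> Ord) : Ord :=
  if `[< exists i, alpha i = ozero >] then ozero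
  else ord_sup (range (nat_prodn alpha)).

Definition refl_closure (T : Type) (R : rel T) : rel T :=
  fun x y => `[< x = y >] || R x y.

(* Orders are strict; [well_order] of wochoice.v expects a reflexive one. *)
Definition linear_order (T : Type) (R : rel T) : Prop :=
  [/\ irreflexive R, transitive R & forall x y, [\/ x = y, R x y | R y x]].

Definition strict_well_order (T : Type) (R : rel T) : Prop :=
  linear_order R /\ well_order (refl_closure R).

Definition has_order_type (T : Type) (R : rel T) (gamma : Ord) : Prop :=
  exists f : T -> Ord,
    set_bij [set: T] [set x | x < gamma] f /\ forall x y, R x y = (f x < f y).

Section finite_support_product.
Variable alpha : nat -> Ord.

Definition fin_supp : Type :=
  {a : nat -> Ord |
    `[< (forall i, a i < alpha i) /\ finite_set [set i | a i != ozero] >]}.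

Definition fin_prod (n : nat) : Type :=
  {a : 'I_n -> Ord | `[< forall i : 'I_n, a i < alpha i >]}.

Lemma restr_subproof n (a : fin_supp) :
  `[< forall i : 'I_n, sval a i < alpha i >].
Proof. by case: a => a /= /asboolP[aP _]; apply/asboolP => i. Qed.

Definition restr n (a : fin_supp) : fin_prod n :=
  exist _ (fun i : 'I_n => sval a i) (restr_subproof n a).

Definition extends_fin_supp (R : rel fin_supp) : Prop :=
  forall a b, a <> b -> (forall i, sval a i <= sval b i) -> R a b.

Definition extends_fin_prod n (R : rel (fin_prod n)) : Prop :=
  forall a b, a <> b -> (forall i, sval a i <= sval b i) -> R a b.

(* [i] is diff(a, b); no such [i] exists when [a = b]. *)
Definition is_diff (a b : fin_supp) (i : nat) : Prop :=
  let D := [set i | (sval a i != ozero \/ sval b i != ozero) /\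
                    sval a i != sval b i] in
  D i /\ forall j, D j -> (j <= i)%N.

Definition finitely_carruth (R : rel fin_supp) : Prop :=
  [/\ linear_order R, extends_fin_supp R &
    exists (n : nat) (Q : rel (fin_prod n)),
      [/\ linear_order Q, extends_fin_prod Q &
        forall (a b : fin_supp) (i : nat), a <> b -> is_diff a b i ->
          ((n <= i)%N -> R a b = (sval a i < sval b i)) /\
          ((i < n)%N -> R a b = Q (restr n a) (restr n b))]].

Definition locally_finitely_carruth (R : rel fin_supp) : Prop :=
  [/\ linear_order R, extends_fin_supp R &
    forall c : fin_supp, exists n : nat,
      forall (a b : fin_supp) (i : nat), a <> b -> is_diff a b i ->
        R a c -> R b c -> (n <= i)%N -> R a b = (sval a i < sval b i)].

End finite_support_product.

Definition is_largest (S : set Ord) (m : Ord) : Prop := S m /\ ubound S m.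

(* Main.v *)
Require Import Defs.
From HB Require Import structures.
From mathcomp Require Import all_boot all_order.
From mathcomp Require Import boolp classical_sets functions cardinality wochoice.

(** Upper bound. Let [R] be a strict weak order on a set whose elements are
  described by coordinates below [alpha_0, ..., alpha_(n-1)], with [R]
  compatible with the componentwise order. Cutting each coordinate along the
  Cantor normal form of [alpha_i] splits the set into boxes whose coordinates
  are below powers [omega^e_i], and natural sums bound unions, so it is enough
  to bound a box by [omega^(e_0 (+) ... (+) e_(n-1))]. There an initial segment
  is a union of sets on which one coordinate is bounded strictly below
  [omega^e_i]; cutting again gives finitely many boxes with a smaller natural
  sum of exponents, and sums of smaller powers stay below the given one. In a
  locally finitely Carruth order an initial segment involves finitely many
  coordinates only, hence the bound [P_n] for it.

  Realization. A shuffle of [e] and [f] into [e (+) f] induces a monotone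
  bijection of [omega^e * omega^f] onto [omega^(e (+) f)]; arranging the blocks
  given by the normal forms of [x] and [y] by decreasing exponents yields a
  monotone bijection of [x * y] onto their natural product. All but finitely
  many [alpha_i] are exceeded or equalled infinitely often. If [n] is beyond the
  exceptions, using natural products before [n] and ordinary ones after it
  gives a finitely Carruth order whose type is the supremum of the
  [P_n * alpha_n * ... * alpha_m]; this dominates every [P_m], because
  [x (x) y <= x * y * ... * y] for enough factors [y]. *)

Set Implicit Arguments.
Unset Strict Implicit.
Unset Printing Implicit Defensive.
Import Order.TTheory.
Local Open Scope classical_set_scope.
Local Open Scope order_scope.

Local Notation "0" := ozero : order_scope.
Local Notation "1" := oone : order_scope.
Local Infix "+o" := ord_add (at level 50, left associativity).
Local Infix "*o" := ord_mul (at level 40, left associativity).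

(** * Ordinal arithmetic *)

Lemma ord_ind (P : Ord -> Prop) :
  (forall x, (forall y, y < x -> P y) -> P x) -> forall x, P x.
Proof. exact: (well_founded_ind ord_lt_wf). Qed.

Lemma ord_ex_least (P : Ord -> Prop) x :
  P x -> exists2 y : Ord, P y & forall z, P z -> y <= z.
Proof. by move=> Px; have [|? ?] := @ord_minP P; [exists x|exists (ord_min P)]. Qed.

Lemma ord_leP (x y : Ord) : reflect (forall z, z < x -> z < y) (x <= y).
Proof.
apply: (iffP idP) => [xy z zx|xy]; first exact: lt_le_trans zx xy.
by rewrite leNgt; apply/negP => /xy; rewrite ltxx.
Qed.

Lemma ord_gt0 (x : Ord) : (0 < x) = (x != 0).
Proof. by rewrite lt_def ozero_le andbT. Qed.

Lemma ord_lt0 (x : Ord) : (x < 0) = false.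
Proof. by apply/negbTE; rewrite -leNgt ozero_le. Qed.

Lemma ord_le0 (x : Ord) : (x <= 0) = (x == 0).
Proof. by rewrite le_eqVlt ord_lt0 orbF. Qed.

Lemma ord_lt1 (x : Ord) : (x < 1) = (x == 0).
Proof. by rewrite ord_lt_succ ord_le0. Qed.

Lemma ord_ge1 (x : Ord) : (1 <= x) = (x != 0).
Proof. by rewrite leNgt ord_lt1. Qed.

Lemma ord_ltS x : x < ord_succ x.
Proof. by rewrite ord_lt_succ. Qed.

(** Arithmetic identities are proved below by comparing the elements under both sides; this unfolds
    the supremum for that purpose, and the variants for [ord_add], [ord_mul] and [omega_pow] come
    from it. *)
Lemma ord_lt_iter G z x y : y < ord_iter G z x <->
  y < z \/ exists2 x', x' < x & y < G (ord_iter G z x').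
Proof.
have [z_le G_le le_F] := ord_iterP G z x; split=> [yF|[/lt_le_trans->//|]].
  apply: contrapT => /not_orP[/negP yz yG]; move: yF; apply/negP.
  rewrite -leNgt le_F// 1?leNgt// => x' x'x; rewrite leNgt; apply/negP => yGx'.
  by apply: yG; exists x'.
by move=> [x' x'x] /lt_le_trans; apply; apply: G_le.
Qed.

Lemma ord_lt_sup (A : set Ord) x : has_ubound A ->
  x < ord_sup A <-> exists2 y, A y & x < y.
Proof.
move=> /ord_supP[ub lub]; split=> [xA|[y Ay xy]]; last exact: lt_le_trans xy (ub _ Ay).
apply: contrapT => nA; move: xA; apply/negP; rewrite -leNgt; apply: lub => y Ay.
by rewrite leNgt; apply/negP => xy; apply: nA; exists y.
Qed.

Lemma range_has_ubound I (u : I -> Ord) : has_ubound (range u).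
Proof. by have [z zP] := ord_seq_bounded u; exists z => _ [n _ <-]; apply/ltW. Qed.

Lemma ord_lt_suprange I (u : I -> Ord) x :
  x < ord_sup (range u) <-> exists i, x < u i.
Proof.
rewrite ord_lt_sup; last exact: range_has_ubound.
by split=> [[_ [i _ <-] ?]|[i ?]]; [exists i|exists (u i) => //; exists i].
Qed.

Lemma ord_lt_add x y z :
  z < x +o y <-> z < x \/ exists2 y', y' < y & z <= x +o y'.
Proof.
rewrite ord_lt_iter; split=> -[|[y' y'y]]; rewrite ?ord_lt_succ; try by left.
- by right; exists y'.
- by right; exists y'; rewrite ?ord_lt_succ.
Qed.

Lemma ord_lt_mul x y z : z < x *o y <-> exists2 y', y' < y & z < x *o y' +o x.
Proof.
by rewrite ord_lt_iter; split=> [[|//]|]; [rewrite ord_lt0|right].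
Qed.

Lemma ord_lt_omega_pow x z :
  z < omega_pow x <-> z = 0 \/ exists2 x', x' < x & z < omega_pow x' *o omega.
Proof.
rewrite ord_lt_iter ord_lt1; split=> -[|?]; by [move=> /eqP; left|right|move=> ->; left].
Qed.

Lemma ord_lt_omega z : z < omega <-> exists n, z < iter n ord_succ 0.
Proof. exact: ord_lt_suprange. Qed.

Lemma ord_ltD2l x : {mono ord_add x : y z / y < z}.
Proof.
apply: leW_mono; apply: le_mono => y z yz.
by apply/ord_lt_add; right; exists y.
Qed.

Lemma ord_leD2l x : {mono ord_add x : y z / y <= z}.
Proof. by move=> y z; rewrite !leNgt ord_ltD2l. Qed.

Lemma ord_addI x : injective (ord_add x).
Proof. exact: inc_inj (ord_leD2l x). Qed.

Lemma ord_leDr x y : y <= x +o y.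
Proof. by rewrite -{1}[y]ord_add0x; apply/ord_add_le2r/ozero_le. Qed.

Lemma ord_leD x x' y y' : x <= x' -> y <= y' -> x +o y <= x' +o y'.
Proof.
by move=> xx' yy'; apply: (le_trans (ord_add_le2r y xx')); rewrite ord_leD2l.
Qed.

Lemma ord_addA x y z : x +o (y +o z) = x +o y +o z.
Proof.
elim/ord_ind: z => z IH; apply/le_anti/andP; split; apply/ord_leP => w.
  move=> /ord_lt_add[wx|[u]]; first exact: lt_le_trans wx (le_trans (ord_le_addr x y) (ord_le_addr _ _)).
  move=> /ord_lt_add[uy|[z' z'z uz']] wu.
    apply: le_lt_trans wu _; apply: lt_le_trans (ord_le_addr _ _).
    by rewrite ord_ltD2l.
  apply: le_lt_trans wu _; apply/ord_lt_add; right; exists z' => //.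
  by rewrite -IH// ord_leD2l.
move=> /ord_lt_add[/lt_le_trans->//|[z' z'z wz']]; first by rewrite ord_leD2l ord_le_addr.
by apply: le_lt_trans wz' _; rewrite -IH// !ord_ltD2l.
Qed.

(** Left subtraction, meant for [y <= x], where the minimum attains equality. *)
Definition ord_sub x y := ord_min [set z | x <= y +o z].

Lemma ord_subK x y : y <= x -> y +o ord_sub x y = x.
Proof.
move=> yx; have [|] := @ord_minP [set z | x <= y +o z].
  by exists x; apply: ord_leDr.
rewrite -/(ord_sub x y) /= => xs slb; apply/le_anti; rewrite xs andbT leNgt.
apply/negP => /ord_lt_add[|[z zs xz]]; first by rewrite ltNge yx.
by have := slb _ xz; rewrite leNgt zs.
Qed.

Lemma ord_lt_sub x y z : y <= x -> (ord_sub x y < z) = (x < y +o z).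
Proof. by move=> yx; rewrite -(ord_ltD2l y) ord_subK. Qed.

Lemma ord_mul_ltS x y z : y < z -> x *o y +o x <= x *o z.
Proof. by move=> yz; rewrite -ord_mulxS; apply: ord_iter_le; rewrite ord_succP. Qed.

Lemma ord_leM x x' y y' : x <= x' -> y <= y' -> x *o y <= x' *o y'.
Proof.
move=> xx' yy'; apply: (le_trans (ord_mul_le2r y xx')).
exact: ord_iter_le.
Qed.

Lemma ord_ltM2l x : 0 < x -> {mono ord_mul x : y z / y < z}.
Proof.
move=> x0; apply: leW_mono; apply: le_mono => y z /(ord_mul_ltS x).
by apply: lt_le_trans; rewrite -[ltLHS]ord_addx0 ord_ltD2l.
Qed.

Lemma ord_mulx1 x : x *o 1 = x.
Proof. by rewrite ord_mulxS ord_mulx0 ord_add0x. Qed.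

Lemma ord_mulDr x y z : x *o (y +o z) = x *o y +o x *o z.
Proof.
elim/ord_ind: z => z IH; apply/le_anti/andP; split; apply/ord_leP => w.
  move=> /ord_lt_mul[u].
  move=> /ord_lt_add[uy|[z' z'z uz']] /lt_le_trans; apply.
    exact: le_trans (ord_mul_ltS _ uy) (ord_le_addr _ _).
  apply: le_trans (ord_leD (ord_leM (lexx x) uz') (lexx x)) _.
  by rewrite IH// -ord_addA ord_leD2l ord_mul_ltS.
move=> /ord_lt_add[/lt_le_trans->//|[u]].
  by apply: ord_leM => //; apply: ord_le_addr.
move=> /ord_lt_mul[z' z'z uz'] wu; apply: le_lt_trans wu _.
have yz'z : y +o z' < y +o z by rewrite ord_ltD2l.
apply: lt_le_trans (ord_mul_ltS x yz'z).
by rewrite IH// -ord_addA ord_ltD2l.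
Qed.

Lemma ord_mulA x y z : x *o (y *o z) = x *o y *o z.
Proof.
elim/ord_ind: z => z IH; apply/le_anti/andP; split; apply/ord_leP => w.
  move=> /ord_lt_mul[u] /ord_lt_mul[z' z'z] uz' /lt_le_trans; apply.
  apply: le_trans (ord_mul_ltS _ z'z); rewrite -IH// -ord_mulDr.
  exact: ord_mul_ltS.
move=> /ord_lt_mul[z' z'z]; rewrite -IH// -ord_mulDr => /lt_le_trans; apply.
by apply: ord_leM => //; apply: ord_mul_ltS.
Qed.

Lemma ord_divP x y z : z < x *o y -> exists q r, [/\ q < y, r < x & z = x *o q +o r].
Proof.
move=> /ord_lt_mul[y' y'y zy'].
(* This least [q] is the quotient: an ordinal below [x *o q] is already below [x *o q' +o x] for
   some [q' < q], so [z] is not below [x *o q]. *)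
have [q zq qlb] := ord_ex_least (P := fun q => z < x *o q +o x) zy'.
have xqz : x *o q <= z.
  rewrite leNgt; apply/negP => /ord_lt_mul[q' q'q /qlb].
  by rewrite leNgt q'q.
exists q, (ord_sub z (x *o q)); rewrite ord_subK// ord_lt_sub//; split=> //.
exact: le_lt_trans (qlb _ zy') y'y.
Qed.

Lemma ord_le_mulr x y : 0 < y -> x <= x *o y.
Proof. by move=> y0; rewrite -{1}[x]ord_mulx1; apply: ord_leM; rewrite // ord_succP. Qed.

Lemma ord_mul2 x : x *o ord_succ 1 = x +o x.
Proof. by rewrite ord_mulxS ord_mulx1. Qed.

Lemma ord_natD m n : iter (m + n) ord_succ 0 = iter n ord_succ 0 +o iter m ord_succ 0.
Proof. by elim: m => [|m IH] /=; rewrite ?ord_addx0// ord_addxS -IH. Qed.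

Lemma ord_nat_lt_omega n : iter n ord_succ 0 < omega.
Proof. by apply/ord_lt_omega; exists n.+1; apply: ord_ltS. Qed.

Lemma omega_pow_homo : {homo omega_pow : x y / x <= y}.
Proof. exact: ord_iter_le. Qed.

Lemma omega_pow_gt0 x : 0 < omega_pow x.
Proof. by apply/ord_lt_omega_pow; left. Qed.

Lemma omega_pow_natlt n x y : x < y -> omega_pow x *o iter n ord_succ 0 < omega_pow y.
Proof.
move=> xy; apply/ord_lt_omega_pow; right; exists x => //.
by rewrite ord_ltM2l ?omega_pow_gt0 ?ord_nat_lt_omega.
Qed.

Lemma ltomega_powP x z : z < omega_pow x ->
  z = 0 \/ exists x' n, x' < x /\ z < omega_pow x' *o iter n ord_succ 0.
Proof.
move=> /ord_lt_omega_pow[|[x' x'x]]; first by left.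
move=> /ord_lt_mul[y /ord_lt_omega[n yn] zy]; right; exists x', n; split=> //.
exact: lt_le_trans zy (ord_mul_ltS _ yn).
Qed.

(** Additive indecomposability: both summands lie below finite multiples of one power, whose
    exponent is the larger of [x1] and [x2], and finite multiples of that power stay below
    [omega_pow x]. *)
Lemma omega_pow_ltD x : forall y z,
  y < omega_pow x -> z < omega_pow x -> y +o z < omega_pow x.
Proof.
move=> y z /[dup] yx /ltomega_powP[->|[x1 [m [x1x ym]]]]; first by rewrite ord_add0x.
move=> /ltomega_powP[->|[x2 [n [x2x zn]]]]; first by rewrite ord_addx0.
have x3x : Order.max x1 x2 < x by rewrite gt_max x1x.
apply: le_lt_trans (omega_pow_natlt (n + m) x3x).
rewrite ord_natD ord_mulDr; apply: ord_leD; apply: (le_trans (ltW _)); try eassumption;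
  by apply/ord_mul_le2r/omega_pow_homo; rewrite le_max lexx ?orbT.
Qed.

Lemma omega_pow_lt : {mono omega_pow : x y / x < y}.
Proof.
apply: leW_mono; apply: le_mono => x y /(omega_pow_natlt 1%N).
by rewrite ord_mulx1.
Qed.

Lemma omega_pow_le : {mono omega_pow : x y / x <= y}.
Proof. by move=> x y; rewrite !leNgt omega_pow_lt. Qed.

Lemma omega_powD_le x y : omega_pow (x +o y) <= omega_pow x *o omega_pow y.
Proof.
elim/ord_ind: y => y IH; apply/ord_leP => z /ord_lt_omega_pow[->|[u]].
  apply: lt_le_trans (omega_pow_gt0 x) _; exact/ord_le_mulr/omega_pow_gt0.
move=> /ord_lt_add[ux|[y' y'y uy']] zu.
  rewrite -omega_powS in zu; apply: lt_le_trans zu _.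
  apply: le_trans (ord_le_mulr _ (omega_pow_gt0 y)).
  by rewrite omega_pow_le ord_succP.
apply: lt_le_trans zu _.
apply: (@le_trans _ _ (omega_pow x *o omega_pow y' *o omega)).
  by apply/ord_mul_le2r/(le_trans _ (IH _ y'y)); rewrite omega_pow_le.
by rewrite -ord_mulA; apply: ord_leM => //; rewrite -omega_powS omega_pow_le ord_succP.
Qed.

Lemma omega_pow_ge x : x <= omega_pow x.
Proof.
elim/ord_ind: x => x IH; apply/ord_leP => y yx; apply: le_lt_trans (IH y yx) _.
by rewrite omega_pow_lt.
Qed.

(** * Cantor normal forms and natural sums *)

Local Notation "x ⊕ y" := (nat_sum x y) (at level 50, left associativity).
Local Notation "x ⊗ y" := (nat_prod x y) (at level 40, left associativity).

Lemma cnf_val_cat s t : cnf_val (s ++ t) = cnf_val s +o cnf_val t.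
Proof. by elim: s => [|e s IH] /=; rewrite ?ord_add0x// IH ord_addA. Qed.

Lemma cnf_val_lt E s : all (< E) s -> cnf_val s < omega_pow E.
Proof.
elim: s => [_|e s IH /= /andP[eE /IH]]; first exact: omega_pow_gt0.
by apply: omega_pow_ltD; rewrite omega_pow_lt.
Qed.

Lemma sorted_geP (x : Ord) s : sorted >=%O (x :: s) = all (<= x) s && sorted >=%O s.
Proof. by rewrite /= path_sortedE//; exact: ge_trans. Qed.

Lemma cnf_exists x : exists s, sorted >=%O s /\ cnf_val s = x.
Proof.
elim/ord_ind: x => x IH; have [->|x0] := eqVneq x 0; first by exists [::].
have xS : x < omega_pow (ord_succ x) by apply: lt_le_trans (ord_ltS x) (omega_pow_ge _).
(* With [m] the least exponent whose power exceeds [x], the leading exponent is the [e < m] such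
   that [x < omega_pow e *o omega]. *)
have [m xm mlb] := ord_ex_least (P := fun e => x < omega_pow e) xS.
have /ord_lt_omega_pow[/eqP|[e em xe]] := xm; first by rewrite (negbTE x0).
have ex : omega_pow e <= x.
  by rewrite leNgt; apply/negP => /mlb; rewrite leNgt em.
(* If the remainder were at least [x], then [omega_pow e +o x <= x]; iterating, all finite multiples
   of [omega_pow e] would be at most [x], against the choice of [e]. *)
have dx : ord_sub x (omega_pow e) < x.
  rewrite ltNge; apply/negP => xd.
  have le_nat n : omega_pow e *o iter n ord_succ 0 +o x <= x.
    elim: n => [|n IHn]; first by rewrite ord_mulx0 ord_add0x.
    rewrite /= ord_mulxS -ord_addA; apply: le_trans IHn.
    by rewrite ord_leD2l -[leRHS](ord_subK ex) ord_leD2l.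
  move: xe => /ord_lt_mul[y /ord_lt_omega[n yn] xy].
  have := lt_le_trans xy (ord_mul_ltS _ yn); apply/negP; rewrite -leNgt.
  exact: le_trans (ord_le_addr _ _) (le_nat n).
have [s [ss sx]] := IH _ dx; exists (e :: s); rewrite /= sx ord_subK//; split=> //.
(* A first exponent [f > e] of the remainder would give [omega_pow (ord_succ e) <= x], again against
   the choice of [e]. *)
case: s ss sx => //= f s -> sx; rewrite andbT leNgt; apply/negP => ef.
move: xe; rewrite -omega_powS ltNge => /negP; apply; apply: le_trans (ltW dx).
by rewrite -sx; apply: le_trans (ord_le_addr _ _); rewrite omega_pow_le ord_succP.
Qed.

(* The lexicographic comparison of the Cantor normal forms with exponents [s]
   and [t], read off the multiplicities so as not to depend on the order of the
   lists. *)
Definition cnf_lt (s t : seq Ord) : Prop :=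
  exists2 e, (count_mem e s < count_mem e t)%N &
    forall f, e < f -> count_mem f s = count_mem f t.

Lemma cnf_lt_catr u s t : cnf_lt s t -> cnf_lt (s ++ u) (t ++ u).
Proof.
move=> [e est eq]; exists e => [|f /eq]; rewrite !count_cat ?ltn_add2r//.
by move=> ->.
Qed.

Lemma cnf_lt_perm s s' t t' :
  perm_eq s s' -> perm_eq t t' -> cnf_lt s t -> cnf_lt s' t'.
Proof.
move=> /permP ss' /permP tt' [e est eq].
by exists e => [|f /eq]; rewrite -ss' -tt'.
Qed.

Lemma count_mem_lt (e : Ord) s : all (< e) s -> count_mem e s = 0%N.
Proof.
by move=> /allP se; apply/count_memPn/negP => /se /=; rewrite ltxx.
Qed.

(** Equal heads are stripped. At the first disagreement the larger head decides: by sortedness it is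
    absent from the other list, and nothing larger occurs in either. *)
Lemma cnf_lt_total s t : sorted >=%O s -> sorted >=%O t ->
  [\/ s = t, cnf_lt s t | cnf_lt t s].
Proof.
have aux x y (s1 t1 : seq Ord) : x < y ->
    sorted >=%O (x :: s1) -> sorted >=%O (y :: t1) -> cnf_lt (x :: s1) (y :: t1).
  move=> xy; rewrite !sorted_geP => /andP[s1x _] /andP[t1y _].
  have lt_s f : y <= f -> count_mem f (x :: s1) = 0%N.
    move=> yf; apply: count_mem_lt => /=; rewrite (lt_le_trans xy yf)/=.
    by apply: sub_all s1x => z /le_lt_trans; apply; apply: lt_le_trans yf.
  exists y => [|f yf]; first by rewrite lt_s//= eqxx.
  rewrite lt_s ?(ltW yf)// count_mem_lt//= yf.
  by apply: sub_all t1y => z /le_lt_trans; apply.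
elim: s t => [|x s IH] [|y t] ss st.
- by constructor 1.
- constructor 2; exists y => [|f yf]; first by rewrite /= eqxx.
  rewrite [RHS]count_mem_lt//= yf; move: st; rewrite sorted_geP => /andP[+ _].
  by apply: sub_all => z /le_lt_trans; apply.
- constructor 3; exists x => [|f xf]; first by rewrite /= eqxx.
  rewrite [RHS]count_mem_lt//= xf; move: ss; rewrite sorted_geP => /andP[+ _].
  by apply: sub_all => z /le_lt_trans; apply.
- have [xy|yx|xy] := ltgtP x y.
  + by constructor 2; apply: aux.
  + by constructor 3; apply: aux.
  + subst y; have [||->|st'|ts'] := IH t; try by apply: path_sorted; eassumption.
    * by constructor 1.
    * constructor 2; case: st' => e est eq; exists e => [|f /eq /= ->//].
      by rewrite /= ltn_add2l.
    * constructor 3; case: ts' => e est eq; exists e => [|f /eq /= ->//].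
      by rewrite /= ltn_add2l.
Qed.

(** If the heads differ, indecomposability puts the list with the smaller head below the power given
    by the larger one; equal heads cancel on the left. *)
Lemma cnf_val_sorted_lt s t : sorted >=%O s -> sorted >=%O t ->
  cnf_lt s t -> cnf_val s < cnf_val t.
Proof.
elim: s t => [|x s IH] [|y t]; try by move=> _ _ [].
  move=> _ _ _ /=; apply: lt_le_trans (ord_le_addr _ _).
  exact: omega_pow_gt0.
rewrite !sorted_geP => /andP[sx ss] /andP[ty st] [e est eq].
have [xy|yx|xy] := ltgtP x y.
- apply: (@lt_le_trans _ _ (omega_pow y)); last exact: ord_le_addr.
  apply: cnf_val_lt; rewrite /= xy.
  by apply: sub_all sx => z /le_lt_trans; apply.
- have t0 f : x <= f -> count_mem f (y :: t) = 0%N.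
    move=> xf; apply: count_mem_lt; rewrite /= (lt_le_trans yx xf)/=.
    by apply: sub_all ty => z /le_lt_trans; apply; apply: lt_le_trans xf.
  have [ex|xe] := ltP e x; last by rewrite t0 in est.
  by have := eq _ ex; rewrite t0//= eqxx.
- subst y; rewrite /= ord_ltD2l; apply: IH => //; exists e => [|f /eq /=].
    by rewrite /= ltn_add2l in est.
  exact: addnI.
Qed.

(** Lists are read as multisets of exponents: concatenation becomes natural sum, and a natural
    product is the multiset of pairwise natural sums. *)
Definition hval (s : seq Ord) : Ord := cnf_val (sort >=%O s).

Lemma sort_ge_sorted (s : seq Ord) : sorted >=%O (sort >=%O s).
Proof. by apply: sort_sorted => x y; apply: le_total. Qed.

Lemma hval_sorted s : sorted >=%O s -> hval s = cnf_val s.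
Proof. by move=> ss; rewrite /hval sorted_sort//; exact: ge_trans. Qed.

Lemma perm_hval s t : perm_eq s t -> hval s = hval t.
Proof.
move=> st; congr cnf_val; apply/perm_sortP => //.
- by move=> x y; apply: le_total.
- exact: ge_trans.
- by move=> x y; rewrite andbC => /le_anti.
Qed.

Lemma hval_lt s t : hval s < hval t <-> cnf_lt s t.
Proof.
have lt u v : cnf_lt u v -> hval u < hval v.
  move=> uv; apply: cnf_val_sorted_lt; rewrite ?sort_ge_sorted//.
  by apply: cnf_lt_perm uv; rewrite perm_sym perm_sort.
split=> [st|]; last exact: lt.
have [E|H|H] := cnf_lt_total (sort_ge_sorted s) (sort_ge_sorted t).
- by move: st; rewrite /hval E ltxx.
- by apply: cnf_lt_perm H; rewrite perm_sort.
- have /lt : cnf_lt t s by apply: cnf_lt_perm H; rewrite perm_sort.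
  by move=> /(lt_trans st); rewrite ltxx.
Qed.

Lemma hval_inj s t : hval s = hval t -> perm_eq s t.
Proof.
move=> st; have [E|H|H] := cnf_lt_total (sort_ge_sorted s) (sort_ge_sorted t).
- by rewrite -(perm_sort >=%O) E perm_sort.
- have /hval_lt : cnf_lt s t by apply: cnf_lt_perm H; rewrite perm_sort.
  by rewrite st ltxx.
- have /hval_lt : cnf_lt t s by apply: cnf_lt_perm H; rewrite perm_sort.
  by rewrite st ltxx.
Qed.

Lemma cnfP x : sorted >=%O (cnf x) /\ cnf_val (cnf x) = x.
Proof.
exact: (@xgetPex _ [::] [set s | sorted >=%O s /\ cnf_val s = x] (cnf_exists x)).
Qed.

Lemma cnf_sorted x : sorted >=%O (cnf x). Proof. by have [] := cnfP x. Qed.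
Lemma cnfK x : cnf_val (cnf x) = x. Proof. by have [] := cnfP x. Qed.
Lemma hval_cnf x : hval (cnf x) = x. Proof. by rewrite hval_sorted ?cnfK ?cnf_sorted. Qed.
Lemma cnf_hval s : perm_eq (cnf (hval s)) s. Proof. exact/hval_inj/hval_cnf. Qed.

Lemma hval1 e : hval [:: e] = omega_pow e.
Proof. by rewrite hval_sorted//= ord_addx0. Qed.

Lemma hval_lt_omega s E : (hval s < omega_pow E) = all (< E) s.
Proof.
apply/idP/idP => [|sE]; last by apply: cnf_val_lt; rewrite all_sort.
rewrite -hval1 => /hval_lt[e].
have [->|eE] := eqVneq e E; rewrite /= ?eqxx; last by rewrite eq_sym (negbTE eE).
rewrite addn0 ltnS leqn0 => /eqP s0 eq; apply/allP => f fs /=; rewrite ltNge le_eqVlt.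
apply/negP => /predU1P[Ef|Ef].
  by move: s0 => /count_memPn; rewrite Ef fs.
by have := eq f Ef; rewrite /= (lt_eqF Ef) => /count_memPn; rewrite fs.
Qed.

Lemma cnf_omega_pow e : cnf (omega_pow e) = [:: e].
Proof.
by apply/perm_small_eq => //; rewrite -hval1; apply: cnf_hval.
Qed.

Lemma cnf_omega_lt x E : (x < omega_pow E) = all (< E) (cnf x).
Proof. by rewrite -hval_lt_omega hval_cnf. Qed.

Lemma hval_cat s t : hval (s ++ t) = hval s ⊕ hval t.
Proof. by apply: perm_hval; rewrite perm_sym; apply: perm_cat; apply: cnf_hval. Qed.

Lemma nat_sumE x y : x ⊕ y = hval (cnf x ++ cnf y). Proof. by []. Qed.

Lemma nat_sumC : commutative nat_sum.
Proof. by move=> x y; rewrite !nat_sumE; apply: perm_hval; rewrite perm_catC. Qed.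

Lemma nat_sumA : associative nat_sum.
Proof.
move=> x y z; rewrite -[x in LHS]hval_cnf -[z in RHS]hval_cnf !(nat_sumE _ y, nat_sumE y).
by rewrite -!hval_cat catA.
Qed.

Lemma nat_sum0x : left_id 0 nat_sum.
Proof. by move=> x; rewrite -[0]/(hval [::]) -[x in LHS]hval_cnf -hval_cat hval_cnf. Qed.

Lemma nat_sumx0 : right_id 0 nat_sum.
Proof. by move=> x; rewrite nat_sumC nat_sum0x. Qed.

HB.instance Definition _ :=
  Monoid.isComLaw.Build Ord 0 nat_sum nat_sumA nat_sumC nat_sum0x.

Lemma nat_sum_ltD2r z : {mono nat_sum^~ z : x y / x < y}.
Proof.
apply: leW_mono; apply: le_mono => x y; rewrite -{1}[x]hval_cnf -{1}[y]hval_cnf.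
by move=> /hval_lt/(@cnf_lt_catr (cnf z))/hval_lt; rewrite !hval_cat !hval_cnf.
Qed.

Lemma nat_sum_ltD2l z : {mono nat_sum z : x y / x < y}.
Proof. by move=> x y; rewrite ![z ⊕ _]nat_sumC nat_sum_ltD2r. Qed.

Lemma nat_sum_leD2l z : {mono nat_sum z : x y / x <= y}.
Proof. by move=> x y; rewrite !leNgt nat_sum_ltD2l. Qed.

Lemma nat_sum_leD x x' y y' : x <= x' -> y <= y' -> x ⊕ y <= x' ⊕ y'.
Proof.
move=> xx' yy'; apply: (@le_trans _ _ (x ⊕ y')); first by rewrite nat_sum_leD2l.
by rewrite ![_ ⊕ y']nat_sumC nat_sum_leD2l.
Qed.

Lemma nat_prodE x y : x ⊗ y = hval [seq e ⊕ f | e <- cnf x, f <- cnf y].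
Proof. by []. Qed.

Lemma cnf1 : cnf 1 = [:: 0].
Proof. by rewrite -omega_pow0 cnf_omega_pow. Qed.

Lemma nat_prodx1 x : x ⊗ 1 = x.
Proof.
rewrite nat_prodE cnf1 /allpairs /= flatten_map1.
by rewrite (eq_map nat_sumx0) map_id hval_cnf.
Qed.

(** * Bounds on compatible orders *)

Section StrictlyIncreasingBound.
Variables (T : Type) (R : rel T).
Hypothesis R_irr : irreflexive R.
Hypothesis R_trans : transitive R.
Hypothesis R_negtrans : forall x y z, R x y -> R x z \/ R z y.
Implicit Types (A B : set T) (x y z : Ord).

(* For a linear order [R] this says that the order type of [A] is at most [x];
   it makes sense, and entails well-foundedness on [A], for any strict weak
   order. *)
Definition bounded_by A x := exists f : T -> Ord,
  (forall a, A a -> f a < x) /\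
  (forall a b, A a -> A b -> R a b -> f a < f b).

Lemma bounded_by_sub A B x : A `<=` B -> bounded_by B x -> bounded_by A x.
Proof.
by move=> AB [f [fx fR]]; exists f; split=> [a /AB/fx|a b /AB Aa /AB Ab /fR->].
Qed.

(** Send [t] to the least [f a] with [a] in [A] not below [t], or to [x] if there is none.
    Transitivity makes this monotone everywhere, and negative transitivity makes it strict above
    elements of [A]. *)
Lemma bounded_by_extend A x : bounded_by A x -> exists f : T -> Ord,
  [/\ forall t, f t <= x, forall t u, R t u -> f t <= f u,
      forall t, A t -> f t < x & forall t u, A t -> R t u -> f t < f u].
Proof.
move=> [f [fx fR]]; pose S t := x |` [set f a | a in [set a | A a /\ ~ R a t]].
have minS t : S t (ord_min (S t)) /\ lbound (S t) (ord_min (S t)).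
  by apply: ord_minP; exists x; left.
have ltS t : A t -> ord_min (S t) <= f t.
  by move=> At; apply: (minS t).2; right; exists t; split=> //; rewrite R_irr.
exists (fun t => ord_min (S t)); split=> [t|t u tu|t At|t u At tu].
- by apply: (minS t).2; left.
- apply: (minS t).2; have [[->|[a [Aa au] <-]] _] := minS u; first by left.
  by right; exists a => //; split=> // /R_trans/(_ tu).
- exact: le_lt_trans (ltS t At) (fx t At).
- apply: le_lt_trans (ltS t At) _; have [[->|[a [Aa au] <-]] _] := minS u.
    exact: fx.
  by apply: fR => //; have [|/au] := R_negtrans a tu.
Qed.

(** Add the two extended maps: at each element of the union one of them increases strictly and the
    other weakly, and natural sum is strictly monotone in both arguments. *)
Lemma bounded_byU A B x y :
  bounded_by A x -> bounded_by B y -> bounded_by (A `|` B) (x ⊕ y).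
Proof.
move=> /bounded_by_extend[f [fx fR fA fAR]] /bounded_by_extend[g [gx gR gB gBR]].
have lt_le u u' v v' : u < u' -> v <= v' -> u ⊕ v < u' ⊕ v'.
  move=> uu' vv'; apply: (@lt_le_trans _ _ (u' ⊕ v)).
    by rewrite nat_sum_ltD2r.
  by rewrite nat_sum_leD2l.
exists (fun t => f t ⊕ g t); split=> [t [/fA|/gB]|t u [/fAR|/gBR] + _ tu].
- by move/lt_le; apply.
- by rewrite nat_sumC [x ⊕ y]nat_sumC => /lt_le; apply.
- by move=> /(_ u tu)/lt_le; apply; apply: gR.
- move=> /(_ u tu); rewrite ![f _ ⊕ _]nat_sumC => /lt_le; apply; exact: fR.
Qed.

(* The rank of [t] in [A], without recursion: the least bound of the elements
   of [A] below [t]. *)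
Definition rank A t : Ord := ord_min [set z | bounded_by [set a | A a /\ R a t] z].

(** A map bounding the predecessors of [t] by [z] bounds those of [s] by its own value at [s], which
    is below [z]. *)
Lemma rank_lt A s t z : A s -> R s t ->
  bounded_by [set a | A a /\ R a t] z -> rank A s < z.
Proof.
move=> As st [f [fz fR]]; apply: (@le_lt_trans _ _ (f s)); last exact: fz.
have bs : bounded_by [set a | A a /\ R a s] (f s).
  exists f; split=> [a [Aa as_]|a b [Aa as_] [Ab bs]].
    by apply: fR => //; split=> //; apply: R_trans st.
  by apply: fR; split=> //; apply: R_trans st.
by have [|_] := @ord_minP [set z | bounded_by [set a | A a /\ R a s] z]; [exists (f s)|apply].
Qed.

Lemma bounded_by_segments A x :
  (forall c, A c -> exists2 z, z < x & bounded_by [set a | A a /\ R a c] z) ->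
  bounded_by A x.
Proof.
move=> Ax; exists (rank A).
have rankP c : A c -> bounded_by [set a | A a /\ R a c] (rank A c) /\
    rank A c < x.
  move=> /Ax[z zx zc].
  have [|bc lb] := @ord_minP [set z | bounded_by [set a | A a /\ R a c] z].
    by exists z.
  by split=> //; apply: le_lt_trans (lb _ zc) zx.
split=> [a /rankP[]//|a b Aa /rankP[+ _] ab]; exact: rank_lt.
Qed.

(** One piece for each term of [l]. On a piece, [q] is what remains of [p] after subtracting the
    preceding terms; comparisons of [q] carry over to [p], so compatibility with the componentwise
    order survives the cut. *)
Lemma bounded_by_cut A (p : T -> Ord) (l : seq Ord) (s : Ord -> seq Ord) :
  (forall a, A a -> p a < cnf_val l) ->
  (forall e B (q : T -> Ord), e \in l -> B `<=` A ->
     (forall a, B a -> q a < omega_pow e) ->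
     (forall a b, B a -> B b -> q a <= q b -> p a <= p b) ->
     bounded_by B (hval (s e))) ->
  bounded_by A (hval (flatten [seq s e | e <- l])).
Proof.
elim: l A p => [|e l IH] A p pl bB.
  by exists (fun=> 0); split=> [a /pl|a b /pl]; rewrite /= ord_lt0.
rewrite /= hval_cat.
apply: (@bounded_by_sub _ ([set a | A a /\ p a < omega_pow e] `|`
    [set a | A a /\ omega_pow e <= p a])).
  by move=> a Aa; have [?|?] := ltP (p a) (omega_pow e); [left|right].
apply: bounded_byU.
  by apply: (bB e _ p) => [|a []|a []|a b _ _]//; rewrite mem_head.
apply: (IH _ (fun a => ord_sub (p a) (omega_pow e))).
  by move=> a [/pl pa ea]; rewrite ord_lt_sub.
move=> f B q fl BA qf qp; apply: (bB f B q) => //.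
- by rewrite in_cons fl orbT.
- by move=> a /BA[].
- move=> a b Ba Bb /(qp _ _ Ba Bb); have [_ ea] := BA a Ba; have [_ eb] := BA b Bb.
  by rewrite -(ord_leD2l (omega_pow e)) !ord_subK.
Qed.

(** Only reversals are forbidden, because distinct elements may share all their coordinates and [R]
    is merely a weak order. *)
Definition box_order n A (p : nat -> T -> Ord) : Prop := forall a b, A a -> A b ->
  (forall i, (i < n)%N -> p i a <= p i b) -> ~~ R b a.

Definition upd (U : Type) (u : nat -> U) m v : nat -> U :=
  fun i => if i == m then v else u i.

Lemma box_order_upd n A B (p : nat -> T -> Ord) m q :
  box_order n A p -> B `<=` A ->
  (forall a b, B a -> B b -> q a <= q b -> p m a <= p m b) ->
  box_order n B (upd p m q).
Proof.
move=> box BA qp a b Ba Bb le_ab; apply: box; [exact: BA|exact: BA|].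
move=> i /le_ab; rewrite /upd; case: eqP => // ->; exact: qp.
Qed.

(* An initial segment determined by [c] is covered by the [n] sets of elements
   having some coordinate smaller than that of [c]; each of those is cut into
   boxes of the same kind with a smaller sum of exponents. *)
Lemma bounded_by_omega_box n (e : nat -> Ord) A (p : nat -> T -> Ord) :
  box_order n A p ->
  (forall a i, A a -> (i < n)%N -> p i a < omega_pow (e i)) ->
  bounded_by A (omega_pow (\big[nat_sum/0]_(0 <= i < n) e i)).
Proof.
move: {-1}(\big[_/_]_(_ <= _ < _) _) (erefl (\big[nat_sum/0]_(0 <= i < n) e i)) => E.
elim/ord_ind: E n e A p => E IH n e A p eE box pe.
apply: bounded_by_segments => c Ac.
(* Lowering one exponent strictly lowers the natural sum, which allows the induction on [E]. *)
have updE m f i : (i < n)%N -> (m < n)%N -> f < e m ->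
    \big[nat_sum/0]_(0 <= i < n) upd e m f i < E.
  move=> _ mn fm; rewrite -eE !big_mkord (bigD1 (Ordinal mn))//=.
  rewrite [ltRHS](bigD1 (Ordinal mn))//= /upd eqxx.
  rewrite (eq_bigr (fun i : 'I_n => e i)) ?nat_sum_ltD2r// => j.
  by rewrite -val_eqE /= => /negbTE ->.
have [l lE bl] : exists2 l, all (< E) l &
    bounded_by [set a | A a /\ exists2 i, (i < n)%N & p i a < p i c] (hval l).
  (* The coordinates are treated one after the other; [l] lists the exponent sums of the boxes met
     so far, all below [E], so that [hval l < omega_pow E]. *)
  suff H m : (m <= n)%N -> exists2 l, all (< E) l &
      bounded_by [set a | A a /\ exists2 i, (i < m)%N & p i a < p i c] (hval l).
    exact: H.
  elim: m => [_|m IHm mn].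
    exists [::] => //; apply: (@bounded_by_sub _ set0) => [a [_ []]//|].
    by exists (fun=> 0); split.
  have [l lE bl] := IHm (ltnW mn).
  pose l' := [seq [:: \big[nat_sum/0]_(0 <= i < n) upd e m f i] | f <- cnf (p m c)].
  have pme : all (< e m) (cnf (p m c)) by rewrite -cnf_omega_lt pe.
  exists (l ++ flatten l').
    rewrite all_cat lE; apply/allP => x /flatten_mapP[f fpm].
    rewrite inE => /eqP -> /=; apply: (updE _ _ m) => //.
    exact: (allP pme).
  rewrite hval_cat; apply: (@bounded_by_sub _
    ([set a | A a /\ exists2 i, (i < m)%N & p i a < p i c] `|`
     [set a | A a /\ p m a < p m c])).
    move=> a [Aa [i]]; rewrite ltnS leq_eqVlt => /predU1P[->|im] ac; [right|left] => //.
    by split=> //; exists i.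
  apply: bounded_byU => //; apply: (@bounded_by_cut _ (p m)) => [a []|f B q fpm BA qf qp].
    by rewrite cnfK.
  have BAA : B `<=` A by move=> a /BA[].
  rewrite hval1; apply: (IH _ _ n _ _ (upd p m q) erefl).
  - by apply: (updE _ _ m) => //; apply: (allP pme).
  - exact: box_order_upd box _ _.
  - by move=> a i Ba ni; rewrite /upd; case: eqP => _; [apply: qf|apply/pe/ni/BAA].
exists (hval l); first by rewrite hval_lt_omega.
apply: bounded_by_sub bl => a [Aa ac]; split=> //; apply: contrapT => nex.
suff /negP : ~~ R a c by apply.
apply: box => // i ni; rewrite leNgt; apply/negP => lt_ac; apply: nex.
by exists i.
Qed.

(** Pairs of exponents are regrouped by the exponent of [y], to match the cut along a coordinate
    bounded by [y]. *)
Lemma nat_prod_cnf_sum x y z :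
  hval [seq e ⊕ z | e <- cnf (x ⊗ y)] =
  hval (flatten [seq [seq e ⊕ (f ⊕ z) | e <- cnf x] | f <- cnf y]).
Proof.
apply: perm_hval; apply: (@perm_trans _ [seq g ⊕ z | g <- [seq e ⊕ f | e <- cnf x, f <- cnf y]]).
  exact/perm_map/cnf_hval.
elim: (cnf y) => [|f t IH]; first by rewrite allpairs0r.
apply: (@perm_trans _ [seq g ⊕ z | g <- [seq e ⊕ f | e <- cnf x] ++
    [seq e ⊕ g | e <- cnf x, g <- t]]).
  by apply/perm_map/permPl/(@perm_allpairs_consr _ (fun=> Ord)).
rewrite map_cat /= -map_comp; apply: perm_cat IH.
by rewrite (eq_map (fun e => esym (nat_sumA e f z))).
Qed.

Lemma bounded_by_box n (alpha : nat -> Ord) A (p : nat -> T -> Ord) :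
  box_order n A p ->
  (forall a i, A a -> (i < n)%N -> p i a < alpha i) ->
  bounded_by A (nat_prodn alpha n).
Proof.
move=> box pa.
(* Coordinates are cut from the last to the first: those before [k] are still bounded by [alpha],
   the others already by powers. At [k = 0] only a box is left. *)
suff H k e : (k <= n)%N -> forall A p, box_order n A p ->
    (forall a i, A a -> (i < k)%N -> p i a < alpha i) ->
    (forall a i, A a -> (k <= i < n)%N -> p i a < omega_pow (e i)) ->
    bounded_by A
      (hval [seq f ⊕ \big[nat_sum/0]_(k <= i < n) e i | f <- cnf (nat_prodn alpha k)]).
  have := H n (fun=> 0) (leqnn n) A p box pa; rewrite big_geq// (eq_map nat_sumx0).
  rewrite map_id hval_cnf; apply=> a i _ /andP[ni /(leq_ltn_trans ni)].
  by rewrite ltnn.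
elim: k e {A p box pa} => [|k IH] e kn A p box pa pe.
  rewrite /= cnf1 /= hval1 nat_sum0x; apply: bounded_by_omega_box box _ => a i Aa ni.
  exact: pe.
rewrite nat_prod_cnf_sum; apply: (@bounded_by_cut _ (p k)).
  by move=> a Aa; rewrite cnfK; apply: pa.
move=> f B q _ BA qf qp; have := IH (upd e k f) (ltnW kn) B (upd p k q).
rewrite big_ltn// /upd eqxx.
under eq_big_nat => i /andP[ki _] do rewrite gtn_eqF//.
apply.
- exact: box_order_upd box _ _.
- by move=> a i Ba ik; rewrite ltn_eqF//; apply/pa/(ltn_trans ik)=> //; apply: BA.
- move=> a i Ba /andP[ki ni]; case: eqP => [_|/eqP ik]; first exact: qf.
  by apply/pe; [apply: BA|rewrite ltn_neqAle eq_sym ik ki].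
Qed.

End StrictlyIncreasingBound.

(** * Order types *)

Lemma ord_le_incr (g : Ord -> Ord) x y : (forall z, z < x -> g z < y) ->
  (forall z z', z < z' -> z' < x -> g z < g z') -> x <= y.
Proof.
move=> gy g_incr; apply/ord_leP => z zx; apply: le_lt_trans (gy z zx).
elim/ord_ind: z zx => z IH zx; apply/ord_leP => w wz.
by apply: le_lt_trans (IH w wz (lt_trans wz zx)) (g_incr _ _ wz zx).
Qed.

Lemma has_order_type_le (T : Type) (R : rel T) x y :
  has_order_type R x -> bounded_by R [set: T] y -> x <= y.
Proof.
move=> [f [[fx _ fsurj] fR]] [g [gy gR]]; apply/ord_leP => _ /fsurj[t _ <-].
apply: le_lt_trans (gy t I).
suff H z : forall t, f t = z -> z <= g t by exact: (H _ t).
elim/ord_ind: z => z IH {}t ft; apply/ord_leP => w wz.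
have [u _ fu] : (f @` [set: T]) w.
  by apply: fsurj; apply: lt_trans wz _; rewrite -ft; apply: fx.
by apply: le_lt_trans (IH w wz u fu) (gR _ _ _ _ _) => //; rewrite fR fu ft.
Qed.

Lemma linear_negtrans (T : Type) (R : rel T) x y z :
  linear_order R -> R x y -> R x z \/ R z y.
Proof.
move=> [_ R_trans R_total] xy.
by have [<-|?|zx] := R_total x z; [right|left|right; apply: R_trans xy].
Qed.

Lemma bounded_by_well_order (T : Type) (R : rel T) x :
  linear_order R -> bounded_by R [set: T] x -> strict_well_order R.
Proof.
move=> R_lin [f [_ fR]]; split=> // A [a Aa]; have [_ _ R_total] := R_lin.
have [z [t At ftz] zlb] :=
  @ord_ex_least (fun z => exists2 t, t \in A & f t = z) (f a) (ex_intro2 _ _ a Aa erefl).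
have tlb b : b \in A -> refl_closure R t b.
  move=> Ab; rewrite /refl_closure; have [->|tb|bt] := R_total t b.
  - by rewrite asboolT.
  - by rewrite tb orbT.
  - by have := zlb (f b) (ex_intro2 _ _ b Ab erefl); rewrite leNgt -ftz fR.
exists t; split=> [//|u [Au ulb]]; have [-> //|tu|ut] := R_total t u.
- have /orP[/asboolP//|ut] := ulb t At.
  by have := lt_trans (fR _ _ I I tu) (fR _ _ I I ut); rewrite ltxx.
- have /orP[/asboolP//|tu] := tlb u Au.
  by have := lt_trans (fR _ _ I I tu) (fR _ _ I I ut); rewrite ltxx.
Qed.

Lemma order_type_exists (T : Type) (R : rel T) x : linear_order R ->
  bounded_by R [set: T] x -> exists g, has_order_type R g.
Proof.
move=> R_lin Rx; have [R_irr R_trans R_total] := R_lin.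
have [g Rg glb] := ord_ex_least Rx.
have segP t : bounded_by R [set a | [set: T] a /\ R a t] (rank R [set: T] t) /\
    rank R [set: T] t < g.
  have [f [fg fR]] := Rg.
  have bt : bounded_by R [set a | [set: T] a /\ R a t] (f t).
    by exists f; split=> [a [_ ?]|a b _ _ ?]; apply: fR.
  have [|bc lb] := @ord_minP [set z | bounded_by R [set a | [set: T] a /\ R a t] z].
    by exists (f t).
  by split=> //; apply: le_lt_trans (lb _ bt) (fg _ _).
set r := rank R [set: T] in segP.
have r_lt s t : R s t -> r s < r t by move=> st; apply: (rank_lt R_trans) (segP t).1.
have r_inj s t : r s = r t -> s = t.
  by move=> e; have [//|/r_lt|/r_lt] := R_total s t; rewrite e ltxx.
exists g, r; split; last first.
  move=> s t; apply/idP/idP => [/r_lt//|st]; have [e|//|/r_lt] := R_total s t.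
    by rewrite e ltxx in st.
  by rewrite ltNge (ltW st).
split=> [t _|s t _ _ /r_inj//|z zg]; first by case: (segP t).
(* If all ranks were below [z], then [z < g] would be a smaller bound than [g]. *)
have [t0 zt0] : exists t, z <= r t.
  apply: contrapT => nex; move: zg; apply/negP; rewrite -leNgt; apply: glb.
  exists r; split=> [t _|]; last by move=> ? ? _ _; apply: r_lt.
  by rewrite ltNge; apply/negP => zt; apply: nex; exists t.
(* Among the elements of rank at least [z], take [t] of least rank: its predecessors have rank below
   [z], so [z] bounds its segment and the rank of [t] is at most [z]. *)
have [w [t zt wt] wlb] :=
  @ord_ex_least (fun w => exists2 t, z <= r t & r t = w) (r t0) (ex_intro2 _ _ t0 zt0 erefl).
exists t => //; apply/le_anti; rewrite zt andbT.
have [|_] := @ord_minP [set z | bounded_by R [set a | [set: T] a /\ R a t] z].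
  by exists (r t); case: (segP t).
apply; exists r; split=> [a [_ at_]|? ? _ _]; last exact: r_lt.
rewrite ltNge; apply/negP => za; have := wlb _ (ex_intro2 _ _ a za erefl).
by rewrite leNgt -wt r_lt.
Qed.

Lemma nat_prod1x x : 1 ⊗ x = x.
Proof.
by rewrite nat_prodE cnf1 /= cats0 (eq_map nat_sum0x) map_id hval_cnf.
Qed.

(** Compare pairs by their value under [F]. This weak order is compatible with the componentwise
    one, hence bounded by the natural product; choosing preimages then embeds [z] increasingly. *)
Lemma nat_prod_max (F : Ord -> Ord -> Ord) x y z :
  (forall a b a' b', a <= a' -> a' < x -> b <= b' -> b' < y -> F a b <= F a' b') ->
  (forall w, w < z -> exists a b, [/\ a < x, b < y & F a b = w]) ->
  z <= x ⊗ y.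
Proof.
move=> F_homo F_surj.
pose R : rel (Ord * Ord) := fun p q => F p.1 p.2 < F q.1 q.2.
pose A := [set p : Ord * Ord | p.1 < x /\ p.2 < y].
have : bounded_by R A (nat_prodn (fun i => if i == 0%N then x else y) 2).
  apply: (@bounded_by_box _ R _ _ _ 2%N _ _ (fun i p => if i == 0%N then p.1 else p.2)).
  - by move=> p; rewrite /R ltxx.
  - by move=> q p s; apply: lt_trans.
  - move=> p q s; rewrite /R => pq; have [ps|sp] := ltP (F p.1 p.2) (F s.1 s.2).
      by left.
    by right; apply: le_lt_trans pq.
  - move=> p q [px py] [qx qy] le_pq; rewrite /R -leNgt; apply: F_homo => //.
      exact: (le_pq 0%N).
    exact: (le_pq 1%N).
  - by move=> p [|[|//]] [px py] _.
rewrite /= nat_prod1x => -[f [fxy fR]].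
have /choice[h hP] w : exists p, w < z -> A p /\ F p.1 p.2 = w.
  have [wz|zw] := ltP w z; last by exists (0, 0).
  by have [a [b [ax bY Fab]]] := F_surj w wz; exists (a, b).
apply: (@ord_le_incr (f \o h)) => [w /hP[Aw _]|w w' ww' w'z]; first exact: fxy.
have [Aw Fw] := hP _ (lt_trans ww' w'z); have [Aw' Fw'] := hP _ w'z.
by apply: fR => //; rewrite /R Fw Fw'.
Qed.

Lemma nat_prod_ler x y : y != 0 -> x <= x ⊗ y.
Proof.
rewrite -ord_gt0 => y0; apply: (@nat_prod_max (fun a _ => a)) => [//|w wx].
by exists w, 0.
Qed.

(** * Finitely supported sequences *)

Section FiniteSupport.
Variable alpha : nat -> Ord.
Implicit Types (a b c : fin_supp alpha) (R : rel (fin_supp alpha)).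

Lemma fin_supp_lt a i : sval a i < alpha i.
Proof. by case: a => a /= /asboolP[]. Qed.

Lemma fin_supp_bound a : exists M, forall i, (M <= i)%N -> sval a i = 0.
Proof.
case: a => a /= /asboolP[_ /finite_seqP[s sE]].
exists (\max_(i <- s) i).+1 => i; apply: contraTeq => ai.
rewrite -ltnNge ltnS; apply: leq_bigmax_seq => //.
by have : [set` s] i by rewrite -sE.
Qed.

Lemma fin_supp_ext a b : (forall i, sval a i = sval b i) -> a = b.
Proof.
case: a b => a pa [b pb] /= ab; have {}ab : a = b by apply/funext.
by subst b; congr exist; apply: Prop_irrelevance.
Qed.

Lemma fin_supp_mk (u : nat -> Ord) M : (forall i, u i < alpha i) ->
  (forall i, (M <= i)%N -> u i = 0) -> exists a, forall i, sval a i = u i.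
Proof.
move=> u_lt u0.
have up : `[< (forall i, u i < alpha i) /\ finite_set [set i | u i != ozero] >].
  apply/asboolP; split=> //; apply: (@sub_finite_set _ _ `I_M); last exact: finite_II.
  by move=> i /=; rewrite ltnNge; apply: contra_neqN => /u0.
by exists (exist _ u up).
Qed.

Lemma is_diffP a b i : is_diff a b i <->
  sval a i <> sval b i /\ forall j, (i < j)%N -> sval a j = sval b j.
Proof.
split=> [[[_ /eqP ab] imax]|[ab imax]]; split=> //; [|split; last exact/eqP|].
- move=> j; apply: contraTeq => ne; rewrite -leqNgt; apply: imax; split=> //.
  have [aj0|] := eqVneq (sval a j) 0; last by left.
  by right; apply/eqP => bj0; rewrite aj0 bj0 eqxx in ne.
- have [ai0|] := eqVneq (sval a i) 0; last by left.
  by right; apply/eqP => bi0; apply/ab; rewrite ai0 bi0.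
- move=> j [_]; rewrite leqNgt; apply: contra => /imax ->; exact: eqxx.
Qed.

Lemma is_diff_exists a b : a <> b -> exists i, is_diff a b i.
Proof.
move=> ab; have [M Ma] := fin_supp_bound a; have [N Nb] := fin_supp_bound b.
have exP : exists i, sval a i != sval b i.
  apply: contrapT => nex; apply/ab/fin_supp_ext => i; apply/eqP/negPn/negP => ne.
  by apply: nex; exists i.
have ubP i : sval a i != sval b i -> (i <= maxn M N)%N.
  rewrite leqNgt; apply: contra => /ltnW.
  by rewrite geq_max => /andP[/Ma -> /Nb ->].
have [i /eqP abi imax] := ex_maxnP exP ubP.
exists i; apply/is_diffP; split=> // j ij; apply/eqP/negPn/negP => /imax.
by rewrite leqNgt ij.
Qed.

Lemma finitely_carruth_locally R : finitely_carruth R -> locally_finitely_carruth R.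
Proof.
move=> [R_lin R_ext [n [Q [_ _ RQ]]]]; split=> // c; exists n => a b i ab d _ _.
by have [+ _] := RQ a b i ab d; apply.
Qed.

(* Condition (1) constrains pairs strictly below some element, so it is used
   below a strict upper bound of [c]; an element [c] without one is the
   componentwise maximum of the product. *)
Lemma segment_support R c : locally_finitely_carruth R ->
  exists n, forall a, a = c \/ R a c -> forall i, (n <= i)%N -> sval a i = 0.
Proof.
move=> [[R_irr R_trans R_total] R_ext R_loc]; have [M Mc] := fin_supp_bound c.
have [[d cd]|cmax] := pselect (exists d, R c d).
  have [n nP] := R_loc d; exists (maxn n M) => a [->|ac] i; rewrite geq_max => /andP[ni Mi].
    exact: Mc.
  apply/eqP/negPn/negP => ai.
  have a_c : a <> c by move=> e; rewrite e R_irr in ac.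
  have [k d_ac] := is_diff_exists a_c; have [_ kmax] := (is_diffP _ _ _).1 d_ac.
  have ik : (i <= k)%N.
    by rewrite leqNgt; apply/negP => /kmax e; rewrite e Mc// eqxx in ai.
  have := nP a c k a_c d_ac (R_trans _ _ _ ac cd) cd (leq_trans ni ik).
  by rewrite ac Mc ?ord_lt0// (leq_trans Mi).
exists M => a _ i Mi; apply/eqP/negPn/negP; rewrite -ord_gt0 => ai.
have [||c' c'E] := @fin_supp_mk (upd (sval c) i (sval a i)) i.+1.
- by move=> j; rewrite /upd; case: eqP => [->|_]; apply: fin_supp_lt.
- move=> j ij; rewrite /upd gtn_eqF//; apply: Mc; exact: leq_trans Mi (ltnW ij).
apply: cmax; exists c'; apply: R_ext => [cc'|j].
  by move: (c'E i); rewrite -cc' /upd eqxx Mc// => ai0; rewrite -ai0 ltxx in ai.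
by rewrite c'E /upd; case: eqP => [->|//]; rewrite Mc// ozero_le.
Qed.

Lemma nat_prodn_le_inf n : (forall i, alpha i != 0) ->
  nat_prodn alpha n <= inf_nat_prod alpha.
Proof.
move=> alpha0; rewrite /inf_nat_prod asboolF; last by move=> [i /eqP]; apply/negP.
by have [ub _] := ord_supP (range_has_ubound (nat_prodn alpha)); apply: ub; exists n.
Qed.

Lemma locally_carruth_bounded R : locally_finitely_carruth R ->
  bounded_by R [set: fin_supp alpha] (inf_nat_prod alpha).
Proof.
move=> R_loc; have [R_lin R_ext _] := R_loc; have [R_irr R_trans R_total] := R_lin.
have negtrans := fun x y z => @linear_negtrans _ R x y z R_lin.
apply: bounded_by_segments => // c _.
have alpha0 i : alpha i != 0.
  by apply/eqP => ai; have := fin_supp_lt c i; rewrite ai ord_lt0.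
have [n nP] := segment_support c R_loc.
(* The box contains [c] itself, so that [f c], which is strictly below [nat_prodn alpha n], bounds
   the elements below [c]. *)
have [||f [fn fR]] := @bounded_by_box _ R R_irr R_trans negtrans n alpha
    [set a | a = c \/ R a c] (fun i a => sval a i).
- move=> a b Aa Ab le_ab; apply/negP => ba.
  have ab : a <> b by move=> e; rewrite e R_irr in ba.
  suff /(R_trans _ _ _ ba) : R a b by rewrite R_irr.
  apply: R_ext => // i; have [/le_ab//|ni] := ltnP i n.
  by rewrite (nP a Aa i ni) ozero_le.
- by move=> a i _ _; apply: fin_supp_lt.
exists (f c); first by apply: lt_le_trans (nat_prodn_le_inf n alpha0); apply: fn; left.
exists f; split=> [a [_ ac]|a b [_ ac] [_ bc]]; apply: fR; by [left|right|].
Qed.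

End FiniteSupport.

(** * Shuffles and blocks of Cantor normal forms *)

(** A partition of [z] into copies of [x] and [y]. Monotonicity is required on all ordinals, so that
    [hval_map_homo] applies to [f] and [g]. *)
Record shuffle (x y z : Ord) (f g : Ord -> Ord) : Prop := Shuffle {
  shuffle_homol : {homo f : u v / u < v};
  shuffle_homor : {homo g : u v / u < v};
  shuffle_ltl : forall u, u < x -> f u < z;
  shuffle_ltr : forall v, v < y -> g v < z;
  shuffle_neq : forall u v, u < x -> v < y -> f u <> g v;
  shuffle_surj : forall w, w < z ->
    (exists2 u, u < x & f u = w) \/ (exists2 v, v < y & g v = w) }.

Lemma shuffle_sym x y z f g : shuffle x y z f g -> shuffle y x z g f.
Proof.
case=> fh gh fz gz fg surj; split=> //.
- by move=> u v uy vx /esym; apply: fg.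
- by move=> w /surj[]; [right|left].
Qed.

Lemma shuffle_addl d x y z f g : shuffle x y z f g ->
  shuffle (d +o x) y (d +o z)
    (fun u => if u < d then u else d +o f (ord_sub u d)) (fun v => d +o g v).
Proof.
case=> fh gh fz gz fg surj; split.
- move=> u v uv; case: (ltP u d) => ud; case: (ltP v d) => vd //.
  + exact: lt_le_trans ud (ord_le_addr _ _).
  + by have := lt_trans (le_lt_trans ud uv) vd; rewrite ltxx.
  + by rewrite ord_ltD2l; apply: fh; rewrite ord_lt_sub// ord_subK.
- by move=> u v uv; rewrite ord_ltD2l; apply: gh.
- move=> u udx; case: (ltP u d) => ud; first exact: lt_le_trans ud (ord_le_addr _ _).
  by rewrite ord_ltD2l; apply: fz; rewrite ord_lt_sub.
- by move=> v vy; rewrite ord_ltD2l; apply: gz.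
- move=> u v udx vy; case: (ltP u d) => ud => [e|/ord_addI].
    by move: ud; rewrite e ltNge ord_le_addr.
  by apply: fg; rewrite // ord_lt_sub.
- move=> w wz; have [wd|dw] := ltP w d.
    left; exists w; first exact: lt_le_trans wd (ord_le_addr _ _).
    by rewrite wd.
  have [|[u ux fu]|[v vy gv]] := surj (ord_sub w d); first by rewrite ord_lt_sub.
    left; exists (d +o u); first by rewrite ord_ltD2l.
    rewrite ltNge ord_le_addr /= -[w in RHS](ord_subK dw) -fu; congr (_ +o f _).
    by apply: (@ord_addI d); rewrite ord_subK// ord_le_addr.
  by right; exists v; rewrite // gv ord_subK.
Qed.

(** The head of the merged list is a largest exponent, so it heads the normal form it comes from.
    Remove it from both, and restore it on that side with [shuffle_addl]. *)
Lemma shuffle_exists x y : exists f g, shuffle x y (x ⊕ y) f g.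
Proof.
rewrite /nat_sum -{1}(cnfK x) -{1}(cnfK y).
set r := sort _ _.
have : perm_eq r (cnf x ++ cnf y) by rewrite perm_sort.
have : sorted >=%O r by apply: sort_ge_sorted.
move: r (cnf x) (cnf y) (cnf_sorted x) (cnf_sorted y) => {x y}.
have head_mem (e : Ord) r s t : sorted >=%O (e :: r) -> sorted >=%O s ->
    perm_eq (e :: r) (s ++ t) -> e \in s -> exists2 s', s = e :: s' & perm_eq r (s' ++ t).
  rewrite sorted_geP => /andP[re _]; case: s => // f s.
  rewrite sorted_geP => /andP[sf _] per; rewrite inE => e_fs.
  have ef : f = e.
    apply/le_anti/andP; split.
      have : f \in e :: r by rewrite (perm_mem per) mem_head.
      by rewrite inE => /predU1P[->//|/(allP re)].
    by case/predU1P: e_fs => [->//|/(allP sf)].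
  by subst f; exists s => //; rewrite -(perm_cons e).
elim=> [|e r IH] s t ss st sr per.
  move: per; rewrite perm_sym => /perm_nilP; case: s ss => // _; case: t st => // _ _.
  by exists id, id; split=> // [u v|w]; rewrite /= ord_lt0.
have : e \in s ++ t by rewrite -(perm_mem per) mem_head.
have sr' : sorted >=%O r by move: sr; rewrite sorted_geP => /andP[].
rewrite mem_cat => /orP[es|et].
  have [s' sE per'] := head_mem _ _ _ _ sr ss per es; subst s.
  have [|f [g fg]] := IH s' t _ st sr' per'; first by move: ss; rewrite sorted_geP => /andP[].
  by eexists _, _; apply: shuffle_addl fg.
rewrite perm_sym perm_catC perm_sym in per.
have [t' tE per'] := head_mem _ _ _ _ sr st per et; subst t.
have [|f [g fg]] := IH t' s _ ss sr' per'; first by move: st; rewrite sorted_geP => /andP[].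
by eexists _, _; apply/shuffle_sym/shuffle_addl; exact: fg.
Qed.

Record mono_bij (x y z : Ord) (f : Ord -> Ord -> Ord) : Prop := MonoBij {
  mono_bij_lt : forall u v, u < x -> v < y -> f u v < z;
  mono_bij_homo : forall u v u' v', u <= u' -> u' < x -> v <= v' -> v' < y ->
    f u v <= f u' v';
  mono_bij_inj : forall u v u' v', u < x -> v < y -> u' < x -> v' < y ->
    f u v = f u' v' -> u = u' /\ v = v';
  mono_bij_surj : forall w, w < z -> exists u v, [/\ u < x, v < y & f u v = w] }.

Lemma ord_mul_mono_bij x y : mono_bij x y (x *o y) (fun u v => x *o v +o u).
Proof.
have aux u v v' : u < x -> v < v' -> x *o v +o u < x *o v'.
  by move=> ux vv'; apply: lt_le_trans (ord_mul_ltS x vv'); rewrite ord_ltD2l.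
split=> [u v ux|u v u' v' uu' ux vv' vy|u v u' v' ux vy ux' vy'|w].
- exact: aux.
- by apply: ord_leD => //; apply: ord_leM.
- have [vv'|vv'|->] := ltgtP v v'; last by move/ord_addI.
  + move=> e; have := aux u v v' ux vv'; rewrite e ltNge.
    by rewrite ord_le_addr.
  + move=> e; have := aux u' v' v ux' vv'; rewrite -e ltNge.
    by rewrite ord_le_addr.
- by move=> /ord_divP[q [r [qy rx ->]]]; exists r, q.
Qed.

Lemma cnf_lt_map (f : Ord -> Ord) s t : {homo f : u v / u < v} ->
  cnf_lt s t -> cnf_lt (map f s) (map f t).
Proof.
move=> fh [e est eq].
have f_inj : injective f by apply: inc_inj; apply: le_mono.
have fmono : {mono f : u v / u < v} by apply: leW_mono; apply: le_mono.
have countE u r : count_mem (f u) (map f r) = count_mem u r.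
  by rewrite count_map; apply: eq_count => v /=; rewrite (inj_eq f_inj).
exists (f e) => [|w ew]; first by rewrite !countE.
have [[u uw]|nw] := pselect (exists u, f u = w).
  by rewrite -uw !countE; apply: eq; rewrite -fmono uw.
by rewrite !(count_memPn _)//; apply/mapP => -[u _ wu]; apply: nw; exists u.
Qed.

Lemma hval_map_homo (f : Ord -> Ord) : {homo f : u v / u < v} ->
  {homo (fun x => hval (map f (cnf x))) : x y / x <= y}.
Proof.
move=> fh x y; rewrite le_eqVlt => /predU1P[->//|xy]; apply/ltW/hval_lt/cnf_lt_map => //.
by apply/hval_lt; rewrite !hval_cnf.
Qed.

(** The images of [f] and [g] are disjoint, so keeping the entries in the image of [f] recovers the
    first list. *)
Lemma shuffle_cnf_inj x y z f g s t s' t' : shuffle x y z f g ->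
  all (< x) s -> all (< y) t -> all (< x) s' -> all (< y) t' ->
  perm_eq (map f s ++ map g t) (map f s' ++ map g t') -> perm_eq s s'.
Proof.
move=> [fh _ _ _ fg _] sx ty sx' ty'.
have f_inj : injective f by apply: inc_inj; apply: le_mono.
move=> /(perm_filter (fun w => `[< exists2 u, u < x & f u = w >])).
have filterE r r' : all (< x) r -> all (< y) r' ->
    [seq w <- map f r ++ map g r' | `[< exists2 u, u < x & f u = w >]] = map f r.
  move=> rx ry; rewrite filter_cat.
  rewrite (@eq_in_filter _ _ predT (map f r)) => [|_ /mapP[u ur ->]]; last first.
    by apply/asboolP; exists u => //; apply: (allP rx).
  rewrite filter_predT (@eq_in_filter _ _ pred0) ?filter_pred0 ?cats0// => _ /mapP[v vr ->].
  by apply/asboolP => -[u ux]; apply: fg => //; apply: (allP ry).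
by rewrite !filterE// => /perm_map_inj; apply.
Qed.

(** An ordinal below [omega_pow (x ⊕ y)] is a multiset of exponents below [x ⊕ y]; the shuffle
    splits it into a multiset of exponents below [x] and one of exponents below [y]. *)
Lemma omega_pow_mono_bij x y :
  exists f, mono_bij (omega_pow x) (omega_pow y) (omega_pow (x ⊕ y)) f.
Proof.
have [f [g fg]] := shuffle_exists x y; have [fh gh fz gz _ surj] := fg.
exists (fun u v => hval (map f (cnf u) ++ map g (cnf v))).
split=> [u v|u v u' v' uu' _ vv' _|u v u' v'|w].
- rewrite hval_lt_omega !cnf_omega_lt => /allP ux /allP vy.
  by rewrite all_cat; apply/andP; split; apply/allP => _ /mapP[w + ->];
    [move/ux/fz|move/vy/gz].
- by rewrite !hval_cat; apply: nat_sum_leD; apply: hval_map_homo.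
- rewrite !cnf_omega_lt => ux vy ux' vy' /hval_inj per.
  have /perm_hval := shuffle_cnf_inj fg ux vy ux' vy' per.
  have := shuffle_cnf_inj (shuffle_sym fg) vy ux vy' ux'.
  rewrite perm_catC perm_sym perm_catC perm_sym => /(_ per)/perm_hval.
  by rewrite !hval_cnf.
- rewrite cnf_omega_lt -{2}(hval_cnf w).
  suff H l : all (< (x ⊕ y)) l -> exists s t,
      [/\ all (< x) s, all (< y) t & perm_eq (map f s ++ map g t) l].
    move=> /H[s [t [sx ty per]]]; exists (hval s), (hval t).
    rewrite !hval_lt_omega; split=> //; rewrite -(perm_hval per).
    by apply: perm_hval; apply: perm_cat; apply/perm_map/cnf_hval.
  elim: l => [_|e l IH /= /andP[/surj exy /IH[s [t [sx ty per]]]]].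
    by exists [::], [::].
  case: exy => -[u uxy ue].
    by exists (u :: s), t; rewrite /= uxy ue perm_cons.
  exists s, (u :: t); rewrite /= uxy ue; split=> //.
  by rewrite -[e :: map g t]cat1s perm_catCA /= perm_cons.
Qed.

Definition block_start (l : seq Ord) k := cnf_val (take k l).

Lemma block_start_le l j k : (j <= k)%N -> block_start l j <= block_start l k.
Proof.
move=> jk; rewrite /block_start -(subnKC jk) takeD cnf_val_cat.
exact: ord_le_addr.
Qed.

Lemma block_lt l k w : (k < size l)%N -> w < omega_pow (nth 0 l k) ->
  block_start l k +o w < block_start l k.+1.
Proof.
move=> kl wk; rewrite /block_start (take_nth 0 kl) -cats1 cnf_val_cat ord_ltD2l.
exact: lt_le_trans wk (ord_le_addr _ _).
Qed.

Lemma block_lt_total l k w : (k < size l)%N -> w < omega_pow (nth 0 l k) ->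
  block_start l k +o w < cnf_val l.
Proof.
move=> kl wk; apply: lt_le_trans (block_lt kl wk) _.
by rewrite -[in leRHS](take_size l); apply: block_start_le.
Qed.

Lemma block_le l j k u w : (j < size l)%N -> u < omega_pow (nth 0 l j) ->
  (k < size l)%N -> w < omega_pow (nth 0 l k) ->
  block_start l j +o u <= block_start l k +o w -> (j < k)%N \/ j = k /\ u <= w.
Proof.
move=> jl uj kl wk; have [jk|kj|->] := ltngtP j k; [by left| |].
  rewrite leNgt (lt_le_trans (block_lt kl wk))//.
  by apply: le_trans (block_start_le l kj) (ord_le_addr _ _).
by rewrite ord_leD2l; right.
Qed.

Lemma block_exists l z : z < cnf_val l -> exists k w,
  [/\ (k < size l)%N, w < omega_pow (nth 0 l k) & z = block_start l k +o w].
Proof.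
elim: l z => [|e l IH] z /=; first by rewrite ord_lt0.
have [ze|ez] := ltP z (omega_pow e).
  by move=> _; exists 0%N, z; rewrite /block_start take0 ord_add0x.
rewrite -ord_lt_sub// => /IH[k [w [kl wk zE]]]; exists k.+1, w; split=> //.
by rewrite /block_start /= -ord_addA -/(block_start l k) -zE ord_subK.
Qed.

Lemma block_choice l : exists (pos : Ord -> nat) (rem : Ord -> Ord),
  forall z, z < cnf_val l -> [/\ (pos z < size l)%N,
    rem z < omega_pow (nth 0 l (pos z)) & z = block_start l (pos z) +o rem z].
Proof.
have /choice[h hP] z : exists p : nat * Ord, z < cnf_val l -> [/\ (p.1 < size l)%N,
    p.2 < omega_pow (nth 0 l p.1) & z = block_start l p.1 +o p.2].
  have [/block_exists[k [w kw]]|lz] := ltP z (cnf_val l); first by exists (k, w).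
  by exists (0%N, 0).
by exists (fun z => (h z).1), (fun z => (h z).2).
Qed.

Lemma block_inj l j k u w : (j < size l)%N -> u < omega_pow (nth 0 l j) ->
  (k < size l)%N -> w < omega_pow (nth 0 l k) ->
  block_start l j +o u = block_start l k +o w -> j = k /\ u = w.
Proof.
move=> jl uj kl wk e.
have := block_le jl uj kl wk; rewrite e => /(_ (lexx _)) [jk|[jk _]].
  have := block_le kl wk jl uj; rewrite e => /(_ (lexx _)) [kj|[kj _]].
    by have := ltn_trans jk kj; rewrite ltnn.
  by rewrite kj ltnn in jk.
by subst k; split=> //; apply: ord_addI e.
Qed.

Lemma nth_cnf_le x i j : (i <= j)%N -> (j < size (cnf x))%N ->
  nth 0 (cnf x) j <= nth 0 (cnf x) i.
Proof.
move=> ij jx; have ge_refl : reflexive (>=%O : rel Ord) by move=> ?; apply: lexx.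
apply: (sorted_leq_nth (@ge_trans _ _) ge_refl 0 (cnf_sorted x)) => //.
exact: leq_ltn_trans ij jx.
Qed.

(* Pairs of exponents of the two Cantor normal forms cut the rectangle into
   blocks, which are laid out by decreasing natural sum of the exponents; ties
   are broken lexicographically, so that the layout extends the componentwise
   order. *)
Lemma nat_prod_mono_bij x y : exists f, mono_bij x y (x ⊗ y) f.
Proof.
have /choice[F FP] (p : Ord * Ord) : exists f,
    mono_bij (omega_pow p.1) (omega_pow p.2) (omega_pow (p.1 ⊕ p.2)) f.
  exact: omega_pow_mono_bij.
pose s := cnf x; pose t := cnf y.
pose ep (p : nat * nat) := (nth 0 s p.1, nth 0 t p.2).
pose E p := (ep p).1 ⊕ (ep p).2.
pose key (p : nat * nat) : Ord^d *l (nat *l nat) := (E p, (p.1, p.2)).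
have key_inj : injective key by move=> [i j] [i' j'] [_ -> ->].
pose P := sort (relpre key <=%O) [seq (i, j) | i <- iota 0 (size s), j <- iota 0 (size t)].
have P_sorted : sorted (relpre key <=%O) P.
  by apply: sort_sorted => p q; apply: le_total.
have memP p : (p \in P) = (p.1 < size s)%N && (p.2 < size t)%N.
  rewrite mem_sort; apply/allpairsP/andP => [[[i j] [+ + ->]]|[ps pt]].
    by rewrite !mem_iota.
  by exists p; rewrite !mem_iota; case: p ps pt.
(* Exponents decrease along a normal form, so moving right in either one does not increase their
   natural sum. *)
have index_lt p q : p \in P -> q \in P -> (p.1 <= q.1)%N -> (p.2 <= q.2)%N ->
    p != q -> (index p P < index q P)%N.
  move=> pP qP pq1 pq2 p_q.
  have key_trans : transitive (relpre key <=%O) by move=> ? ? ?; apply: le_trans.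
  have key_refl : reflexive (relpre key <=%O) by move=> ?; apply: lexx.
  have le_pq : key p <= key q.
    move: pP qP; rewrite !memP => /andP[ps pt] /andP[qs qt].
    rewrite !lexi_pair leEdual /E nat_sum_leD ?nth_cnf_le//= !leEnat pq1 pq2.
    by rewrite !implybT.
  rewrite ltnNge; apply/negP.
  move=> /(sorted_leq_index key_trans key_refl P_sorted _ _ qP pP) /= le_qp.
  by move/eqP: p_q; apply; apply/key_inj/le_anti; rewrite le_pq.
pose L := map E P.
have LE : cnf_val L = x ⊗ y.
  rewrite -hval_sorted.
    rewrite nat_prodE; apply: perm_hval; rewrite /L.
    apply: (@perm_trans _ (map E [seq (i, j) | i <- iota 0 (size s), j <- iota 0 (size t)])).
      by apply: perm_map; rewrite perm_sort.
    rewrite map_allpairs -[in X in perm_eq _ X](mkseq_nth 0 (cnf x)).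
    by rewrite -[in X in perm_eq _ X](mkseq_nth 0 (cnf y)) allpairs_mapl allpairs_mapr.
  rewrite sorted_map; apply: sub_sorted P_sorted => p q /=.
  by rewrite lexi_pair leEdual => /andP[].
have sizeL : size L = size P by rewrite size_map.
have [posx [remx xP]] := block_choice s; have [posy [remy yP]] := block_choice t.
have {}xP u : u < x -> [/\ (posx u < size s)%N, remx u < omega_pow (nth 0 s (posx u))
    & u = block_start s (posx u) +o remx u] by move=> ux; apply: xP; rewrite cnfK.
have {}yP u : u < y -> [/\ (posy u < size t)%N, remy u < omega_pow (nth 0 t (posy u))
    & u = block_start t (posy u) +o remy u] by move=> uy; apply: yP; rewrite cnfK.
pose pos u v := (posx u, posy v).
pose rem u v := F (ep (pos u v)) (remx u) (remy v).
have posP u v : u < x -> v < y -> pos u v \in P.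
  by move=> /xP[ux _ _] /yP[vy _ _]; rewrite memP ux.
have remP u v : u < x -> v < y -> (index (pos u v) P < size L)%N /\
    rem u v < omega_pow (nth 0 L (index (pos u v) P)).
  move=> ux vy; have uvP := posP u v ux vy.
  rewrite sizeL index_mem uvP; split=> //.
  rewrite (nth_map (0%N, 0%N)) ?index_mem// nth_index// /E.
  by have [_ rx _] := xP u ux; have [_ ry _] := yP v vy; apply: (mono_bij_lt (FP _)).
exists (fun u v => block_start L (index (pos u v) P) +o rem u v); split.
- move=> u v ux vy; rewrite -LE; have [? ?] := remP u v ux vy.
  exact: block_lt_total.
- move=> u v u' v' uu' ux' vv' vy'.
  have ux := le_lt_trans uu' ux'; have vy := le_lt_trans vv' vy'.
  have [iL wL] := remP u v ux vy.
  have [px rx uE] := xP u ux; have [px' rx' uE'] := xP u' ux'.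
  have [py ry vE] := yP v vy; have [py' ry' vE'] := yP v' vy'.
  have lex : (posx u < posx u')%N \/ posx u = posx u' /\ remx u <= remx u'.
    by apply: (block_le px rx px' rx'); rewrite -uE -uE'.
  have ley : (posy v < posy v')%N \/ posy v = posy v' /\ remy v <= remy v'.
    by apply: (block_le py ry py' ry'); rewrite -vE -vE'.
  have [e|ne] := eqVneq (pos u v) (pos u' v').
    rewrite /rem e ord_leD2l; have [ex ey] := e.
    case: lex => [|[_ lex]]; first by rewrite ex ltnn.
    case: ley => [|[_ ley]]; first by rewrite ey ltnn.
    by apply: (mono_bij_homo (FP _)) => //=.
  (* In distinct blocks it suffices that the first one ends no later than the second begins. *)
  apply: le_trans (ord_le_addr _ _); apply/ltW/(lt_le_trans (block_lt iL wL)).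
  apply/block_start_le/index_lt; rewrite ?posP//=.
    by case: lex => [/ltnW|[->]].
  by case: ley => [/ltnW|[->]].
- move=> u v u' v' ux vy ux' vy' e.
  have [iL wL] := remP u v ux vy; have [iL' wL'] := remP u' v' ux' vy'.
  have [ie re] := block_inj iL wL iL' wL' e.
  have pe : pos u v = pos u' v'.
    by rewrite -(nth_index (0%N, 0%N) (posP u v ux vy)) ie nth_index// posP.
  move: re; rewrite /rem pe.
  have [px rx uE] := xP u ux; have [px' rx' uE'] := xP u' ux'.
  have [py ry vE] := yP v vy; have [py' ry' vE'] := yP v' vy'.
  have [ex ey] := pe; rewrite ex in rx uE; rewrite ey in ry vE.
  by case/(mono_bij_inj (FP _)) => //= rxE ryE; rewrite uE vE rxE ryE -uE' -vE'.
- move=> w; rewrite -LE => /block_exists[k [w' [kL w'k wE]]].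
  rewrite sizeL in kL; pose p := nth (0%N, 0%N) P k.
  have pP : p \in P by apply: mem_nth.
  have /andP[ps pt] : (p.1 < size s)%N && (p.2 < size t)%N by rewrite -memP.
  rewrite (nth_map (0%N, 0%N)) // -/p in w'k.
  have [u' [v' [u'p v'p w'E]]] := mono_bij_surj (FP (ep p)) w'k.
  have ux : block_start s p.1 +o u' < x by rewrite -[ltRHS]cnfK block_lt_total.
  have vy : block_start t p.2 +o v' < y by rewrite -[ltRHS]cnfK block_lt_total.
  exists (block_start s p.1 +o u'), (block_start t p.2 +o v'); split=> //.
  have [px rx /(block_inj ps u'p px rx)[pE rE]] := xP _ ux.
  have [py ry /(block_inj pt v'p py ry)[qE sE]] := yP _ vy.
  rewrite /rem /pos -pE -qE -rE -sE -surjective_pairing w'E wE.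
  by rewrite index_uniq// sort_uniq allpairs_uniq ?iota_uniq// => -[? ?] [? ?].
Qed.

(** * Natural versus ordinary products *)

Lemma hval_cons e s : all (<= e) s -> hval (e :: s) = omega_pow e +o hval s.
Proof.
move=> se; rewrite (@perm_hval (e :: s) (e :: sort >=%O s)).
  by rewrite hval_sorted// sorted_geP all_sort se sort_ge_sorted.
by rewrite perm_cons perm_sym perm_sort.
Qed.

Lemma nat_sum_addl e x y : all (<= e) (cnf x) -> all (<= e) (cnf y) ->
  (omega_pow e +o x) ⊕ y = omega_pow e +o (x ⊕ y).
Proof.
move=> xe ye; rewrite -{1}(hval_cnf x) -(hval_cons xe) -{1}(hval_cnf y) -hval_cat.
by rewrite cat_cons hval_cons// all_cat xe.
Qed.

Lemma cnf_val_sorted s : sorted >=%O s -> cnf (cnf_val s) = s.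
Proof.
move=> ss; apply: (@sorted_eq _ >=%O); [exact: ge_trans|exact: ge_anti|exact: cnf_sorted|by []|].
by rewrite -hval_sorted//; apply: cnf_hval.
Qed.

Lemma nat_sum_lt_omega d x y :
  x < omega_pow d -> y < omega_pow d -> x ⊕ y < omega_pow d.
Proof.
rewrite -{2}(hval_cnf x) -{2}(hval_cnf y) -hval_cat hval_lt_omega !cnf_omega_lt all_cat.
by move=> -> ->.
Qed.

(** Terms with exponent [d] are peeled off on the left; what is left is a natural sum of two
    ordinals below [omega_pow d]. *)
Lemma nat_sum_absorb d s x : sorted >=%O s -> all (<= d) s -> x < omega_pow d ->
  cnf_val s ⊕ x <= cnf_val s +o omega_pow d.
Proof.
move=> ss sd xd; have xd' : all (<= d) (cnf x).
  by move: xd; rewrite cnf_omega_lt; apply: sub_all => z /ltW.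
elim: s ss sd => [_ _|e s IH]; first by rewrite nat_sum0x ord_add0x ltW.
rewrite sorted_geP => /andP[se ss] /= /andP[]; rewrite le_eqVlt => /predU1P[->|ed] sd.
  by rewrite nat_sum_addl ?cnf_val_sorted// -ord_addA ord_leD2l IH.
apply: le_trans (ord_leDr _ _); apply/ltW/nat_sum_lt_omega => //.
apply: (@cnf_val_lt d (e :: s)); rewrite /= ed.
by apply: sub_all se => z /le_lt_trans; apply.
Qed.

(** Let [d] be the leading exponent of [y]. Terms of [x] with exponent at least [d] are peeled off;
    the rest of [x] is below [omega_pow d] and is absorbed by a second copy of [y]. *)
Lemma nat_sum_le_add x y : x ⊕ y <= x +o y +o y.
Proof.
case yE: (cnf y) (cnf_sorted y) (cnfK y) => [|d t] ys yK.
  by rewrite -yK nat_sumx0 !ord_addx0.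
have yd : all (<= d) (d :: t) by move: ys; rewrite sorted_geP /= lexx => /andP[].
rewrite -(cnfK x); elim: (cnf x) (cnf_sorted x) => [_|e s IH].
  by rewrite nat_sum0x ord_add0x ord_le_addr.
rewrite sorted_geP => /andP[se ss].
have [de|ed] := leP d e.
  rewrite /= nat_sum_addl ?cnf_val_sorted//; last first.
    by rewrite yE; apply: sub_all yd => z /le_trans; apply.
  by rewrite -!ord_addA ord_leD2l ord_addA IH.
have sd : cnf_val (e :: s) < omega_pow d.
  by apply: cnf_val_lt; rewrite /= ed; apply: sub_all se => z /le_lt_trans; apply.
rewrite -ord_addA; apply: le_trans (ord_leDr _ _).
rewrite nat_sumC -{1}yK; apply: le_trans (nat_sum_absorb ys yd sd) _.
by rewrite yK ord_leD2l -yK ord_le_addr.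
Qed.

Lemma cnf_val_le_mul e s : all (<= e) s ->
  cnf_val s <= omega_pow e *o iter (size s) ord_succ 0.
Proof.
elim: s => [_|f s IH /= /andP[fe /IH sE]]; first exact: ozero_le.
rewrite -[ord_succ _]/(iter (1 + size s) ord_succ 0) addnC ord_natD ord_mulDr ord_mulx1.
by apply: ord_leD => //; apply: omega_pow_homo.
Qed.

Lemma ord_mul_nat_le n x y : 1 < y ->
  x *o iter n ord_succ 0 <= iter n (ord_mul^~ y) x.
Proof.
move=> y1; have y0 : 0 < y by apply: le_lt_trans (ozero_le _) y1.
elim: n => [|n IH] /=; first by rewrite ord_mulx0 ozero_le.
have x_le : x <= iter n (ord_mul^~ y) x.
  by elim: n {IH} => //= n IH; apply: le_trans IH (ord_le_mulr _ y0).
rewrite ord_mulxS; apply: (le_trans (ord_leD IH x_le)).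
by rewrite -ord_mul2; apply: ord_leM => //; rewrite ord_succP.
Qed.

Lemma nat_prod_le_iter x y : x != 0 -> 1 < y ->
  exists n, x ⊗ y <= iter n (ord_mul^~ y) x.
Proof.
move=> x0 y1; have y0 : y != 0 by rewrite -ord_gt0; apply: le_lt_trans (ozero_le _) y1.
case xE: (cnf x) (cnf_sorted x) (cnfK x) => [|a s] xs xK.
  by move: x0; rewrite -xK eqxx.
case yE: (cnf y) (cnf_sorted y) (cnfK y) => [|b t] ys yK.
  by move: y0; rewrite -yK eqxx.
pose l := [seq e ⊕ f | e <- cnf x, f <- cnf y].
(* With leading exponents [a] and [b], the product is at most [size l] copies of
   [omega_pow (a ⊕ b)], itself at most [x *o y *o y] since [a ⊕ b <= a +o b +o b]. This uses two
   factors [y]; the multiple is absorbed by [size l] more, as [1 < y]. *)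
exists (size l + 2)%N; rewrite iterD /=.
have lead (z e : Ord) r : cnf z = e :: r -> all (<= e) (cnf z) /\ omega_pow e <= z.
  move=> zE; have := cnf_sorted z; rewrite zE sorted_geP /= lexx => /andP[-> _].
  by rewrite -{1}(cnfK z) zE ord_le_addr.
have [/allP xa ax] := lead _ _ _ xE; have [/allP yb by_] := lead _ _ _ yE.
have l_le : all (<= (a ⊕ b)) (sort >=%O l).
  rewrite all_sort; apply/allP => _ /allpairsP[[e f] /= [/xa ea /yb fb ->]].
  exact: nat_sum_leD.
apply: (@le_trans _ _ (omega_pow (a ⊕ b) *o iter (size l) ord_succ 0)).
  by rewrite -(size_sort >=%O); apply: cnf_val_le_mul.
apply: le_trans (ord_mul_nat_le _ _ y1); apply: ord_mul_le2r.
apply: (@le_trans _ _ (omega_pow (a +o b +o b))).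
  by rewrite omega_pow_le nat_sum_le_add.
apply: le_trans (omega_powD_le _ _) _; apply: ord_leM => //.
by apply: le_trans (omega_powD_le _ _) _; apply: ord_leM.
Qed.

(** A monotone bijection for [x] is extended to the larger rectangle by the constant [x ⊗ y], and
    [nat_prod_max] applies there. *)
Lemma nat_prod_homol y : {homo nat_prod^~ y : x x' / x <= x'}.
Proof.
move=> x x' xx'; have [f [fxy fle _ fsurj]] := nat_prod_mono_bij x y.
apply: (@nat_prod_max (fun a b => if a < x then f a b else x ⊗ y)).
  move=> a b a' b' aa' a'x bb' b'y; case: (ltP a x) => ax; case: (ltP a' x) => a'x_ //.
  - exact: fle.
  - by apply/ltW/fxy => //; apply: le_lt_trans b'y.
  - by have := le_lt_trans (le_trans ax aa') a'x_; rewrite ltxx.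
move=> w /fsurj[a [b [ax bY abw]]]; exists a, b; rewrite ax; split=> //.
exact: lt_le_trans xx'.
Qed.

(** Call an index bad if all later values from some point on are below its own. Past that point for
    a bad index of minimal value, another bad index would have a smaller value. *)
Lemma eventually_recurrent (alpha : nat -> Ord) : exists n, forall i k,
  (n <= i)%N -> exists2 j, (k <= j)%N & alpha i <= alpha j.
Proof.
pose bad i := exists k, forall j, (k <= j)%N -> alpha j < alpha i.
have goodP i k : ~ bad i -> exists2 j, (k <= j)%N & alpha i <= alpha j.
  move=> nbad; apply: contrapT => nj; apply: nbad; exists k => j kj.
  by rewrite ltNge; apply/negP => ij; apply: nj; exists j.
have [[i0 bad0]|nobad] := pselect (exists i, bad i); last first.
  by exists 0%N => i k _; apply: goodP => badi; apply: nobad; exists i.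
have [_ [i1 [n nP] <-] imin] := @ord_ex_least (fun z => exists2 i, bad i & alpha i = z)
  (alpha i0) (ex_intro2 _ _ i0 bad0 erefl).
exists n => i k ni; apply: goodP => badi.
by have := imin _ (ex_intro2 _ _ i badi erefl); rewrite leNgt nP.
Qed.

(** * Folding binary bijections along a sequence *)

Section IteratedBijection.
Variables (alpha A : nat -> Ord) (f : nat -> Ord -> Ord -> Ord).
Hypothesis A0 : A 0%N = 1.
Hypothesis f_bij : forall k, mono_bij (A k) (alpha k) (A k.+1) (f k).
Implicit Types a b : nat -> Ord.

Fixpoint iter_bij m a : Ord := if m is k.+1 then f k (iter_bij k a) (a k) else 0.

Lemma iter_bij_eq m a b : (forall i, (i < m)%N -> a i = b i) -> iter_bij m a = iter_bij m b.
Proof.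
by elim: m => //= m IH ab; rewrite ab// IH// => i im; apply/ab/(ltn_trans im).
Qed.

Lemma iter_bij_lt m a : (forall i, (i < m)%N -> a i < alpha i) -> iter_bij m a < A m.
Proof.
elim: m => [_|m IH aP]; first by rewrite A0 ord_lt1.
by apply: (mono_bij_lt (f_bij m)); [apply: IH => i im; apply/aP/(ltn_trans im)|apply: aP].
Qed.

Lemma iter_bij_le m a b : (forall i, (i < m)%N -> a i <= b i) ->
  (forall i, (i < m)%N -> b i < alpha i) -> iter_bij m a <= iter_bij m b.
Proof.
elim: m => // m IH ab bP; apply: (mono_bij_homo (f_bij m)).
- by apply: IH => i im; [apply/ab/(ltn_trans im)|apply/bP/(ltn_trans im)].
- by apply: iter_bij_lt => i im; apply/bP/(ltn_trans im).
- exact: ab.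
- exact: bP.
Qed.

Lemma iter_bij_inj m a b : (forall i, (i < m)%N -> a i < alpha i) ->
  (forall i, (i < m)%N -> b i < alpha i) -> iter_bij m a = iter_bij m b ->
  forall i, (i < m)%N -> a i = b i.
Proof.
elim: m => // m IH aP bP.
have aP' i : (i < m)%N -> a i < alpha i by move=> im; apply/aP/(ltn_trans im).
have bP' i : (i < m)%N -> b i < alpha i by move=> im; apply/bP/(ltn_trans im).
move=> /(mono_bij_inj (f_bij m) (iter_bij_lt aP') (aP m (ltnSn m))
  (iter_bij_lt bP') (bP m (ltnSn m)))[/(IH aP' bP') ab abm] i.
by rewrite ltnS leq_eqVlt => /predU1P[->|/ab].
Qed.

Lemma iter_bij_surj m z : z < A m -> exists a, [/\ forall i, (i < m)%N -> a i < alpha i,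
  forall i, (m <= i)%N -> a i = 0 & iter_bij m a = z].
Proof.
elim: m z => [|m IH] z; first by rewrite A0 ord_lt1 => /eqP ->; exists (fun=> 0).
move=> /(mono_bij_surj (f_bij m))[u [v [/IH[a [aP a0 au]] vm <-]]].
exists (upd a m v); split=> [i|i mi|].
- rewrite ltnS leq_eqVlt => /predU1P[->|im]; first by rewrite /upd eqxx.
  by rewrite /upd ltn_eqF// aP.
- by rewrite /upd gtn_eqF// a0// ltnW.
- rewrite /= /upd eqxx -au; congr (f m _ _).
  by apply: iter_bij_eq => i im; rewrite ltn_eqF.
Qed.

Variable n : nat.
Hypothesis f_lex : forall k u v, (n <= k)%N -> f k u v = A k *o v +o u.

(** From [n] on, a zero coordinate contributes [A k *o 0] and leaves the value unchanged. *)
Lemma iter_bij_stable m m' a : (n <= m)%N -> (m <= m')%N ->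
  (forall i, (m <= i)%N -> a i = 0) -> iter_bij m' a = iter_bij m a.
Proof.
move=> nm mm' a0; rewrite -(subnKC mm'); elim: (m' - m)%N => [|d IH]; first by rewrite addn0.
by rewrite addnS /= f_lex ?(leq_trans nm) ?leq_addr// a0 ?leq_addr// ord_mulx0 ord_add0x.
Qed.

(** From [n] on, equal coordinates add the same ordinal on the left, which cancels. *)
Lemma iter_bij_above m m' a b : (n <= m)%N -> (m <= m')%N ->
  (forall i, (m <= i)%N -> a i = b i) ->
  (iter_bij m' a < iter_bij m' b) = (iter_bij m a < iter_bij m b).
Proof.
move=> nm mm' ab; rewrite -(subnKC mm'); elim: (m' - m)%N => [|d IH]; first by rewrite addn0.
rewrite addnS /= ![f _ _ _]f_lex ?(leq_trans nm) ?leq_addr// ab ?leq_addr//.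
by rewrite ord_ltD2l IH.
Qed.

Lemma iter_bij_lex i m a b : (forall j, (j < m)%N -> a j < alpha j) ->
  (n <= i)%N -> (i < m)%N ->
  (forall j, (i < j)%N -> a j = b j) -> a i < b i -> iter_bij m a < iter_bij m b.
Proof.
move=> aP ni im ab abi; rewrite (@iter_bij_above i.+1)//; last exact: leqW.
rewrite /= ![f _ _ _]f_lex//; apply: lt_le_trans (ord_le_addr _ _).
apply: lt_le_trans (ord_mul_ltS _ abi); rewrite ord_ltD2l.
by apply: iter_bij_lt => j ji; apply/aP/(ltn_trans ji).
Qed.

End IteratedBijection.

(** * The realizing order *)

Section CarruthOrder.
Variables (alpha A : nat -> Ord) (f : nat -> Ord -> Ord -> Ord) (n : nat).
Hypothesis A0 : A 0%N = 1.
Hypothesis f_bij : forall k, mono_bij (A k) (alpha k) (A k.+1) (f k).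
Hypothesis f_lex : forall k u v, (n <= k)%N -> f k u v = A k *o v +o u.
Variable M : fin_supp alpha -> nat.
Hypothesis M_ge : forall a, (n <= M a)%N.
Hypothesis M_supp : forall a i, (M a <= i)%N -> sval a i = 0.
Implicit Types a b : fin_supp alpha.

Definition carruth_rank a : Ord := iter_bij f (M a) (sval a).

Definition carruth_order : rel (fin_supp alpha) :=
  fun a b => carruth_rank a < carruth_rank b.

Let fin_supp_ltm a m i : (i < m)%N -> sval a i < alpha i.
Proof. by move=> _; apply: fin_supp_lt. Qed.

(** The choice of [M a] is immaterial, so any two elements can be compared at a common stage. *)
Lemma carruth_rankE a m : (M a <= m)%N -> carruth_rank a = iter_bij f m (sval a).
Proof. by move=> am; rewrite (iter_bij_stable f_lex (M_ge a) am)//; apply: M_supp. Qed.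

Lemma carruth_rankE2 a b m : (maxn (M a) (M b) <= m)%N ->
  carruth_rank a = iter_bij f m (sval a) /\ carruth_rank b = iter_bij f m (sval b).
Proof. by rewrite geq_max => /andP[am bm]; split; apply: carruth_rankE. Qed.

Lemma carruth_rank_inj : injective carruth_rank.
Proof.
move=> a b; have [-> ->] := carruth_rankE2 (leqnn (maxn (M a) (M b))) => ab.
apply: fin_supp_ext => i; have [im|] := ltnP i (maxn (M a) (M b)).
  exact: (iter_bij_inj A0 f_bij (@fin_supp_ltm a _) (@fin_supp_ltm b _) ab).
by rewrite geq_max => /andP[/M_supp -> /M_supp ->].
Qed.

Lemma carruth_order_linear : linear_order carruth_order.
Proof.
split=> [a|b a c|a b]; rewrite /carruth_order ?ltxx//; first exact: lt_trans.
have [ab|ba|/carruth_rank_inj ->] := ltgtP (carruth_rank a) (carruth_rank b).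
- by constructor 2.
- by constructor 3.
- by constructor 1.
Qed.

Lemma carruth_order_extends : extends_fin_supp carruth_order.
Proof.
move=> a b ab le_ab; rewrite /carruth_order lt_neqAle; apply/andP; split.
  by apply/eqP => /carruth_rank_inj.
have [-> ->] := carruth_rankE2 (leqnn (maxn (M a) (M b))).
by apply: (iter_bij_le A0 f_bij) => i; [move=> _; apply: le_ab|apply: fin_supp_ltm].
Qed.

(** Padding by zeros, since [iter_bij] takes sequences indexed by [nat]. *)
Definition fin_prod_ext (u : fin_prod alpha n) : nat -> Ord :=
  fun i => oapp (sval u) 0 (insub i).

Lemma fin_prod_extE u (i : 'I_n) : fin_prod_ext u i = sval u i.
Proof. by rewrite /fin_prod_ext valK. Qed.

Lemma fin_prod_ext_lt u i : (i < n)%N -> fin_prod_ext u i < alpha i.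
Proof.
move=> ni; rewrite -[i]/(val (Ordinal ni)) fin_prod_extE.
by case: u => u /= /asboolP.
Qed.

Lemma fin_prod_ext_restr a i : (i < n)%N -> fin_prod_ext (restr n a) i = sval a i.
Proof. by move=> ni; rewrite -[i]/(val (Ordinal ni)) fin_prod_extE. Qed.

Definition carruth_base : rel (fin_prod alpha n) :=
  fun u v => iter_bij f n (fin_prod_ext u) < iter_bij f n (fin_prod_ext v).

Lemma carruth_base_inj u v :
  iter_bij f n (fin_prod_ext u) = iter_bij f n (fin_prod_ext v) -> u = v.
Proof.
move=> /(iter_bij_inj A0 f_bij (@fin_prod_ext_lt u) (@fin_prod_ext_lt v)) uv.
have {}uv : sval u = sval v.
  by apply/funext => i; rewrite -!fin_prod_extE uv.
case: u v uv => u pu [v pv] /= uv; subst v; congr exist; exact: Prop_irrelevance.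
Qed.

Lemma carruth_base_linear : linear_order carruth_base.
Proof.
split=> [u|v u w|u v]; rewrite /carruth_base ?ltxx//; first exact: lt_trans.
have [uv|vu|/carruth_base_inj ->] :=
  ltgtP (iter_bij f n (fin_prod_ext u)) (iter_bij f n (fin_prod_ext v)).
- by constructor 2.
- by constructor 3.
- by constructor 1.
Qed.

Lemma carruth_base_extends : extends_fin_prod carruth_base.
Proof.
move=> u v uv le_uv; rewrite /carruth_base lt_neqAle; apply/andP; split.
  by apply/eqP => /carruth_base_inj.
apply: (iter_bij_le A0 f_bij) => i ni; last exact: fin_prod_ext_lt.
by rewrite -[i]/(val (Ordinal ni)) !fin_prod_extE.
Qed.

Lemma carruth_order_finitely : finitely_carruth carruth_order.
Proof.
split; [exact: carruth_order_linear|exact: carruth_order_extends|].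
exists n, carruth_base; split; [exact: carruth_base_linear|exact: carruth_base_extends|].
move=> a b i _ /is_diffP[abi ab]; rewrite /carruth_order.
pose m := maxn i.+1 (maxn (M a) (M b)).
have [-> ->] := carruth_rankE2 (leq_maxr i.+1 (maxn (M a) (M b)) : (_ <= m)%N).
have im : (i < m)%N by apply: leq_maxl.
split=> ni.
  have [lt_ab|lt_ba|//] := ltgtP (sval a i) (sval b i).
    exact: (iter_bij_lex A0 f_bij f_lex (@fin_supp_ltm a m) ni im ab).
  apply/negbTE; rewrite -leNgt ltW//.
  by apply: (iter_bij_lex A0 f_bij f_lex (@fin_supp_ltm b m) ni im) => // j /ab.
have nm : (n <= m)%N by apply: leq_trans (M_ge a) _; rewrite /m !leq_max leqnn orbT.
(* Here [i < n], so all coordinates from [n] on agree and the comparison descends to stage [n]. *)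
rewrite (iter_bij_above f_lex (leqnn n) nm) => [|j nj]; last exact/ab/(leq_trans ni).
by rewrite /carruth_base; congr (_ < _); apply: iter_bij_eq => j jn;
  rewrite fin_prod_ext_restr.
Qed.

Lemma carruth_order_type : (forall i, alpha i != 0) ->
  has_order_type carruth_order (ord_sup (range (fun k => A (n + k)%N))).
Proof.
move=> alpha0; exists carruth_rank; split=> //; split.
- move=> a _; apply/ord_lt_suprange; exists (M a - n)%N.
  by rewrite subnKC//; apply: (iter_bij_lt A0 f_bij) => i; apply: fin_supp_ltm.
- by move=> a b _ _ /carruth_rank_inj.
- move=> z /ord_lt_suprange[k /(iter_bij_surj A0 f_bij)[u [u_lt u0 uz]]].
  have {}u_lt i : u i < alpha i.
    by have [/u_lt//|/u0 ->] := ltnP i (n + k); rewrite ord_gt0.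
  have [a aE] := fin_supp_mk u_lt u0.
  exists a => //; rewrite (carruth_rankE (leq_maxl (M a) (n + k))) -uz.
  rewrite (@iter_bij_eq _ _ _ u) => [|i _]; last exact: aE.
  by rewrite (iter_bij_stable f_lex (leq_addr k n) (leq_maxr _ _) u0).
Qed.

End CarruthOrder.

(** * Mixed products against natural products *)

Fixpoint mixed_prod (alpha : nat -> Ord) n k : Ord :=
  if k is j.+1 then
    if (j < n)%N then mixed_prod alpha n j ⊗ alpha j else mixed_prod alpha n j *o alpha j
  else 1.

Lemma mixed_prod_nat alpha n k : (k <= n)%N -> mixed_prod alpha n k = nat_prodn alpha k.
Proof. by elim: k => //= k IH kn; rewrite kn IH// ltnW. Qed.

Lemma mixed_prodS alpha n k : (n <= k)%N ->
  mixed_prod alpha n k.+1 = mixed_prod alpha n k *o alpha k.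
Proof. by move=> nk /=; rewrite ltnNge nk. Qed.

Section MixedProduct.
Variables (alpha : nat -> Ord) (n : nat).
Hypothesis alpha0 : forall i, alpha i != 0.
Hypothesis alpha_rec : forall i k, (n <= i)%N -> exists2 j, (k <= j)%N & alpha i <= alpha j.
Let A := mixed_prod alpha n.

Lemma mixed_prod_le j k : (n <= j)%N -> (j <= k)%N -> A j <= A k.
Proof.
move=> nj jk; rewrite -(subnKC jk); elim: (k - j)%N => [|d IH]; first by rewrite addn0.
rewrite addnS /A mixed_prodS ?(leq_trans nj) ?leq_addr//; apply: le_trans IH _.
by apply: ord_le_mulr; rewrite ord_gt0.
Qed.

Lemma nat_prodn_le j k : (j <= k)%N -> nat_prodn alpha j <= nat_prodn alpha k.
Proof.
move=> jk; rewrite -(subnKC jk); elim: (k - j)%N => [|d IH]; first by rewrite addn0.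
by rewrite addnS /=; apply: le_trans IH (nat_prod_ler _ _).
Qed.

(** Recurrence supplies, arbitrarily far out, a factor at least [alpha i]; each of the [m]
    multiplications is absorbed by a new such factor. *)
Lemma mixed_prod_iter m k i : (n <= i)%N -> (n <= k)%N ->
  exists2 k', (n <= k')%N & iter m (ord_mul^~ (alpha i)) (A k) <= A k'.
Proof.
move=> ni nk; elim: m => [|m [k' nk' IH]]; first by exists k.
have [j k'j ij] := alpha_rec k' ni; have nj := leq_trans nk' k'j.
exists j.+1; first exact: leqW.
rewrite /= /A mixed_prodS//; apply: ord_leM => //.
exact: le_trans IH (mixed_prod_le nk' k'j).
Qed.

Lemma nat_prodn_le_mixed m : exists2 k, (n <= k)%N & nat_prodn alpha m <= A k.
Proof.
have [mn|nm] := leqP m n.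
  by exists n => //; rewrite /A mixed_prod_nat//; apply: nat_prodn_le.
rewrite -(subnKC (ltnW nm)); elim: (m - n)%N => [|d [k nk IH]].
  by exists n; rewrite // addn0 /A mixed_prod_nat.
rewrite addnS /=; set i := (n + d)%N; have ni : (n <= i)%N by apply: leq_addr.
(* The factor [1] is set apart because [nat_prod_le_iter] requires [1 < y]. *)
have [ai1|ai1] := leP (alpha i) 1.
  have -> : alpha i = 1 by apply/le_anti; rewrite ai1 ord_ge1 alpha0.
  by exists k; rewrite // nat_prodx1.
have Ak0 : A k != 0.
  rewrite -ord_ge1; apply: le_trans (mixed_prod_le (leqnn n) nk).
  by rewrite /A mixed_prod_nat// -[1]/(nat_prodn alpha 0); apply: nat_prodn_le.
have [j jP] := nat_prod_le_iter Ak0 ai1; have [k' nk' k'P] := mixed_prod_iter j ni nk.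
exists k' => //; apply: le_trans k'P; apply: le_trans jP.
exact: nat_prod_homol.
Qed.

End MixedProduct.

Lemma carruth_exists alpha : exists R : rel (fin_supp alpha),
  finitely_carruth R /\ has_order_type R (inf_nat_prod alpha).
Proof.
have [n n_rec] := eventually_recurrent alpha.
pose A := mixed_prod alpha n.
have /choice[f0 f0P] k : exists f, mono_bij (A k) (alpha k) (A k.+1) f /\
    ((n <= k)%N -> f = fun u v => A k *o v +o u).
  rewrite /A /=; have [kn|nk] := ltnP k n; last by eexists; split; last by [];
    apply: ord_mul_mono_bij.
  by have [f fP] := nat_prod_mono_bij (A k) (alpha k); exists f.
have f_bij k := (f0P k).1.
have f_lex k u v : (n <= k)%N -> f0 k u v = A k *o v +o u by move=> /(f0P k).2 ->.
have /choice[M MP] (a : fin_supp alpha) : exists m, (n <= m)%N /\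
    forall i, (m <= i)%N -> sval a i = 0.
  have [m mP] := fin_supp_bound a; exists (maxn n m); split; first exact: leq_maxl.
  by move=> i; rewrite geq_max => /andP[_ /mP].
have M_ge a := (MP a).1; have M_supp a := (MP a).2.
have A0 : A 0%N = 1 by [].
pose R := carruth_order f0 M.
have R_fc : finitely_carruth R := carruth_order_finitely A0 f_bij f_lex M_ge M_supp.
exists R; split=> //.
(* If some [alpha i] is zero, there are no finitely supported sequences and the order type is
   zero. *)
have [alpha0|] := pselect (forall i, alpha i != 0); last first.
  move=> /existsNP[i /negP/negPn/eqP ai].
  have no_elt (a : fin_supp alpha) : False.
    by have := fin_supp_lt a i; rewrite ai ord_lt0.
  rewrite /inf_nat_prod asboolT; last by exists i.
  exists (fun=> 0); split=> [|a]; last by case: (no_elt a).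
  by split=> [a|a|z]; [case: (no_elt a)|case: (no_elt a)|rewrite /= ord_lt0].
suff -> : inf_nat_prod alpha = ord_sup (range (fun k => A (n + k)%N)).
  exact: carruth_order_type.
apply/le_anti/andP; split.
  rewrite /inf_nat_prod asboolF; last by move=> [i /eqP]; apply/negP.
  apply/ord_leP => z /ord_lt_suprange[m zm]; apply/ord_lt_suprange.
  have [k nk mk] := nat_prodn_le_mixed alpha0 n_rec m.
  by exists (k - n)%N; rewrite subnKC//; apply: lt_le_trans mk.
(* The converse inequality is the general upper bound applied to [R] itself. *)
apply: (@has_order_type_le _ R); first exact: carruth_order_type.
exact/locally_carruth_bounded/finitely_carruth_locally.
Qed.

Theorem theorem3p1 (alpha : nat -> Ord) :
  (exists R : rel (fin_supp alpha),
     finitely_carruth R /\ has_order_type R (inf_nat_prod alpha)) /\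
  (forall R : rel (fin_supp alpha),
     finitely_carruth R \/ locally_finitely_carruth R ->
     strict_well_order R /\ exists gamma, has_order_type R gamma) /\
  is_largest
    [set gamma | exists R : rel (fin_supp alpha),
                   finitely_carruth R /\ has_order_type R gamma]
    (inf_nat_prod alpha) /\
  is_largest
    [set gamma | exists R : rel (fin_supp alpha),
                   locally_finitely_carruth R /\ has_order_type R gamma]
    (inf_nat_prod alpha).
Proof.
have [R [R_fc R_type]] := carruth_exists alpha.
split; first by exists R.
split=> [S S_c|].
  have {S_c}S_loc : locally_finitely_carruth S.
    by case: S_c => // /finitely_carruth_locally.
  have [S_lin _ _] := S_loc; have S_bd := locally_carruth_bounded S_loc.
  by split; [apply: bounded_by_well_order S_bd|apply: order_type_exists S_bd].
split; split.
- by exists R.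
- move=> g [S [/finitely_carruth_locally/locally_carruth_bounded S_bd S_type]].
  exact: has_order_type_le S_type S_bd.
- by exists R; split=> //; apply: finitely_carruth_locally.
- move=> g [S [/locally_carruth_bounded S_bd S_type]].
  exact: has_order_type_le S_type S_bd.
Qed.
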